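(* Let $\nu>-1$ and let $P_n^\nu(x)=\sum_{k=0}^na_{n,k}x^k$, $n\in\mathbb{N}_0$, be the orthonormal polynomials with positive leading coefficients for the weight $e^{-x}\rho_\nu(x)$ on $(0,\infty)$, i.e. $\int_0^\infty P_m^\nu(x)P_n^\nu(x)e^{-x}\rho_\nu(x)\,dx=\delta_{n,m}$. For $x>0$ let $h_x>0$ be the radius of convergence of the power series $G(x,z)=\sum_{n=0}^\infty P_n^\nu(x)\frac{z^n}{n!}$ in $z$. Then for $x>0$ and $z\in\mathbb{C}$ with $|z|<h_x$, $$G(x,z)=\sum_{n=0}^\infty\sum_{k=0}^{2n}\sum_{j=0}^k\frac{(-1)^j\,f_{2n,k}}{n!\,j!\,(k-j)!}\,x^{j/2}r_j(2\sqrt x;\nu)\,z^n+\frac{\rho_{\nu+1}(x)}{\rho_\nu(x)}\sum_{n=0}^\infty\sum_{k=0}^{2n}\sum_{j=0}^k\frac{(-1)^j\,f_{2n,k}}{n!\,j!\,(k-j)!}\,x^{(j-1)/2}r_{j-1}(2\sqrt x;\nu-1)\,z^n,$$ where $r_{-1}(z;\nu)=0$, $$x^{j/2}r_j(2\sqrt x;\nu)=(-1)^j\sum_{i=0}^{\lfloor j/2\rfloor}(\nu+i-j+1)_{j-2i}\,(j-2i+1)_i\,\frac{x^i}{i!},\quad j\in\mathbb{N}_0,$$ and $$f_{2n,k}=-\frac{a_{n,0}}{D_n}\sum_{r=0}^nD_{n,r}\,r!\,(1+\nu)_r\;{}_3F_2(-k,\,1+\nu+r,\,1+r;\,1+\nu,\,1;\,1),$$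 with $D_n$, $D_{n,r}$ defined in the context.
   Context: $\rho_\nu(x)=2x^{\nu/2}K_\nu(2\sqrt x)=\int_0^\infty t^{\nu-1}e^{-t-x/t}\,dt$ for $x>0$, $\nu\in\mathbb{R}$, where $K_\nu$ is the modified Bessel function. ${}_3F_2$ is the (here terminating) generalized hypergeometric series; $(a)_k$ is the Pochhammer symbol. $\Psi(a,b;z)$ is the Tricomi confluent hypergeometric function, $\Psi(a,b;z)=\frac1{\Gamma(a)}\int_0^\infty e^{-zt}t^{a-1}(1+t)^{b-a-1}dt$ for $a,z>0$. For $k,m\in\mathbb{N}_0$, $$d_{k,m}=\Gamma(1+\nu)\sum_{r=0}^k(-1)^{k+r}\binom{k}{r}\frac{(1+\nu)_k}{(1+\nu)_r}\,\Gamma(1+\nu+k+r+m)\,\Psi(1+m,\,1-\nu-k-r;\,1).$$ For $n\ge1$, $D_n$ is the determinant of the $n\times n$ matrix whose entry in row $m$ ($m=0,\dots,n-1$) and column $j$ ($j=1,\dots,n$) is $d_{j,m}$. For $1\le k\le n$, $D_{n,k}$ is the determinant obtained from $D_n$ by replacing its column $j=k$ by the column $(d_{0,0},d_{0,1},\dots,d_{0,n-1})^T$; and $D_{n,0}:=-D_n$. For $n=0$: $D_0:=1$, $D_{0,0}:=-1$.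
   Formalization: In both series the coefficient (-1)^j f_{2n,k}/(n! j! (k-j)!) is multiplied by k!/j!; as printed, the coefficient of z would force ρ_{ν+1}(x)/ρ_ν(x) = ν+1/2 for all x>0, which is false (for ν=-1/2 the ratio is √x). *)

(* Defs.v *)
(* MathComp-Analysis, over an arbitrary realType R; complex numbers are R[i]
   from mathcomp-real-closed. *)
From HB Require Import structures.
From mathcomp Require Import all_boot all_order all_algebra.
From mathcomp Require Import all_classical all_reals all_analysis.
From mathcomp Require Export complex.

Set Implicit Arguments.
Unset Strict Implicit.
Unset Printing Implicit Defensive.

Import Order.TTheory GRing.Theory Num.Theory.
Import numFieldNormedType.Exports.

Local Open Scope classical_set_scope.
Local Open Scope ring_scope.
Local Open Scope complex_scope.

(* (a)_n = a (a + 1) ... (a + n - 1) *)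
Definition poch (R : pzRingType) (a : R) (n : nat) : R :=
  \prod_(i < n) (a + i%:R).

(* Euler's integral; only used at positive arguments, where it converges. *)
Definition Gamma (R : realType) (a : R) : R :=
  \int[lebesgue_measure]_(t in `]0, +oo[) (t `^ (a - 1) * expR (- t)).

(* Psi(a, b; z), only used for a, z > 0, where the integral converges. *)
Definition tricomi (R : realType) (a b z : R) : R :=
  (Gamma a)^-1 *
  \int[lebesgue_measure]_(t in `]0, +oo[)
     (expR (- (z * t)) * t `^ (a - 1) * (1 + t) `^ (b - a - 1)).

(* rho_nu(x) = 2 x^(nu/2) K_nu(2 sqrt x), for x > 0, taken through its integral
   representation. *)
Definition rho (R : realType) (nu x : R) : R :=
  \int[lebesgue_measure]_(t in `]0, +oo[)
     (t `^ (nu - 1) * expR (- t - x / t)).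

Definition hyp3F2 (R : realType) (a b c d e z : R) : R :=
  limn (series (fun i : nat =>
    poch a i * poch b i * poch c i / (poch d i * poch e i) * z ^+ i / i`!%:R)).

(* As P n has size n + 1, its leading coefficient is that of x^n. *)
Definition orthonormal_polys (R : realType) (nu : R) (P : nat -> {poly R}) : Prop :=
  [/\ forall n, size (P n) = n.+1,
      forall n, 0 < lead_coef (P n) &
      forall m n, \int[lebesgue_measure]_(x in `]0, +oo[)
        ((P m).[x] * (P n).[x] * expR (- x) * rho nu x) = (m == n)%:R].

Definition dcoef (R : realType) (nu : R) (k m : nat) : R :=
  Gamma (1 + nu) *
  \sum_(r < k.+1) (-1) ^+ (k + r) * 'C(k, r)%:R *
     (poch (1 + nu) k / poch (1 + nu) r) *
     Gamma (1 + nu + (k + r + m)%:R) *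
     tricomi (1 + m%:R) (1 - nu - (k + r)%:R) 1.

(* The column indices of the determinants run over 1, ..., n, hence j.+1. *)
Definition Ddet (R : realType) (nu : R) (n : nat) : R :=
  \det (\matrix_(m < n, j < n) dcoef nu j.+1 m).

Definition Ddet_col (R : realType) (nu : R) (n k : nat) : R :=
  if k == 0%N then - Ddet nu n
  else \det (\matrix_(m < n, j < n)
               if j.+1 == k then dcoef nu 0 m else dcoef nu j.+1 m).

(* f_{2n,k}; a_{n,0} is the constant coefficient of P n. *)
Definition fcoef (R : realType) (nu : R) (P : nat -> {poly R}) (n k : nat) : R :=
  - ((P n)`_0 / Ddet nu n) *
  \sum_(r < n.+1) Ddet_col nu n r * r`!%:R * poch (1 + nu) r *
     hyp3F2 (- k%:R) (1 + nu + r%:R) (1 + r%:R) (1 + nu) 1 1.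

(* The product x^(j/2) r_j(2 sqrt x; nu), with r_{-1} = 0. *)
Definition xr (R : realType) (nu x : R) (j : int) : R :=
  match j with
  | Posz j =>
      (-1) ^+ j *
      \sum_(i < (j./2).+1)
         poch (nu + i%:R - j%:R + 1) (j - 2 * i)%N *
         poch ((j - 2 * i)%N%:R + 1) i * (x ^+ i / i`!%:R)
  | Negz _ => 0
  end.

(* Coefficient of x^(j/2) r_j(2 sqrt x; nu) z^n in the first series, and of
   x^((j-1)/2) r_{j-1}(2 sqrt x; nu-1) z^n in the second one.  It comes from
     P_n(x) rho_nu(x) = int_0^oo t^(nu-1) e^(-t-x/t) q(t) dt,
       where q = \sum_(k <= 2n) f_{2n,k} L_k^nu,
     int_0^oo t^(nu-1) e^(-t-x/t) L_k^nu(t) dt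
       = int_0^oo t^(nu-1) e^(-t-x/t) L_k^0(x/t) dt
       = \sum_(j <= k) (-1)^j (k! / j!) / (j! (k-j)!) x^j rho_{nu-j}(x),
     x^j rho_{nu-j}(x) = x^(j/2) r_j(2 sqrt x; nu) rho_nu(x)
       + x^((j-1)/2) r_{j-1}(2 sqrt x; nu-1) rho_{nu+1}(x).
   The factor k! / j! is missing from the formula in the source, which without
   it already fails for the coefficient of z^1. *)
Definition gcoef (R : realType) (nu : R) (P : nat -> {poly R}) (n k j : nat) : R :=
  (-1) ^+ j * (k`!%:R / j`!%:R) * fcoef nu P n k /
  (n`!%:R * j`!%:R * (k - j)%N`!%:R).

(* Radius of convergence of \sum_n c_n z^n in the complex variable z: the
   supremum, possibly +oo, of the |z| at which the series converges.  The
   regular module R[i]^o carries the topology of the complex modulus. *)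
Definition convergence_radius (R : realType) (c : nat -> R) : \bar R :=
  ereal_sup [set (complex.Re `|z|)%:E | z in
    [set z : R[i] | cvgn (series (fun n : nat => (c n)%:C * z ^+ n : R[i]^o))]].

(* Main.v *)
(* Both series are computed coefficientwise: the first one has the same terms as
   G, and the terms of the second one vanish (rho_(nu+1) / rho_nu is not a rational
   function of x).
   - d_(k,m) is Gamma(1+nu) / m! times the moment of order k + m of the weight, so
     by Cramer's rule the ratios of determinants are the coefficients of P_n.
   - The 3F2 is a k-th difference at 0 of T_r(y) = (1+nu+y)_r (1+y)_r. Newton's
     formula turns the sum over k into the j-th difference at -1-j, and these
     differences satisfy the recurrence which is dual to the one of
     x^j rho_(nu-j), whence the sum is x^r.
   - The weight is bounded below near x, so that expressing the value at x of a
     polynomial of degree n by finite differences of its primitive gives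
     P_n(x) = O(2^n n): G is entire in z. *)
Require Import Defs.
From mathcomp Require Import all_boot all_order all_algebra.
From mathcomp Require Import all_classical all_reals all_analysis.
From mathcomp Require Import measurable_realfun.
From mathcomp Require Import ring lra zify.
From mathcomp Require Import complex.

Set Implicit Arguments.
Unset Strict Implicit.
Unset Printing Implicit Defensive.

Import Order.TTheory GRing.Theory Num.Theory.
Import numFieldNormedType.Exports.

Local Open Scope classical_set_scope.
Local Open Scope ring_scope.
Local Open Scope complex_scope.

(** One computation settles both series: for every solution [Y] of
    [Y_(j+2) + (nu - j - 1) Y_(j+1) = x Y_j], the double sum over [k] and [j] with [Y_j] in place of
    the special functions equals [P_n(x) Y_0 / n!]. The two families in the theorem solve this
    recurrence with [Y_0 = 1] and [Y_0 = 0]. The determinant [D_n] is a denominator, so it has to be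
    nonzero. Its columns start at 1; up to nonzero row factors it is therefore the Hankel
    determinant of the weight [x e^(-x) rho_nu(x)], and a kernel vector is a polynomial [q] for
    which [x q^2] integrates to 0 against [e^(-x) rho_nu]. The pointwise bound that makes G entire
    excludes this too: it holds for all multiples of [q] with the same constant. The integrals are
    handled without integration by parts. They are kept nonnegative and extended-real until
    finiteness is proved, and Tonelli's theorem exchanges orders of integration. The moments become
    a double integral symmetric in its two parameters: a shift of one parameter is an algebraic
    identity under the integral, and symmetry transfers it to the other one. *)

Lemma poch0 (R : pzRingType) (a : R) : poch a 0 = 1.
Proof. by rewrite /poch big_ord0. Qed.

Lemma pochSl (R : pzRingType) (a : R) n : poch a n.+1 = a * poch (a + 1) n.
Proof.
rewrite /poch big_ord_recl /= addr0; congr (_ * _).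
by apply: eq_bigr => i _; rewrite /bump /= add1n -addrA -[i.+1%:R]natr1 [1 + _]addrC.
Qed.

Lemma pochSr (R : pzRingType) (a : R) n : poch a n.+1 = poch a n * (a + n%:R).
Proof. by rewrite /poch big_ord_recr. Qed.

Lemma pochD (R : pzRingType) (a : R) m n :
  poch a (m + n) = poch a m * poch (a + m%:R) n.
Proof.
elim: n m => [|n IH] m; first by rewrite addn0 poch0 mulr1.
by rewrite addnS !pochSr IH natrD mulrA addrA.
Qed.

Lemma poch_nat (R : pzRingType) m n :
  (m`!%:R * poch (m%:R + 1) n)%R = (m + n)`!%:R :> R.
Proof.
elim: n => [|n IH]; first by rewrite poch0 mulr1 addn0.
rewrite pochSr mulrA IH addnS factS natrM.
rewrite (_ : m%:R + 1 + n%:R = (m + n).+1%:R); last by rewrite -[RHS]natr1 natrD addrAC.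
by rewrite -!natrM mulnC.
Qed.

Lemma poch_gt0 (R : numDomainType) (a : R) n : 0 < a -> 0 < poch a n.
Proof. by move=> a0; apply: prodr_gt0 => i _; rewrite ltr_wpDr. Qed.

(** * The polynomials [x^(j/2) r_j(2 sqrt x; nu)] and their three-term recurrence *)

Section Macdonald_recurrence.
Variables (R : numFieldType).
Implicit Types nu x : R.

(** Binomial form of the coefficients in [xr]. As ['C(j - i, i)] vanishes for [j < 2 * i], the
    summation range over [i] can be enlarged freely. *)
Definition mac_coef nu j i : R :=
  'C(j - i, i)%:R * poch (nu + i%:R - j%:R + 1) (j - 2 * i).

Lemma mac_coef_eq0 nu j i : (j < 2 * i)%N -> mac_coef nu j i = 0.
Proof. by move=> ji; rewrite /mac_coef bin_small ?mul0r//; lia. Qed.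

Lemma mac_coefE nu j i : (2 * i <= j)%N ->
  mac_coef nu j i =
  poch (nu + i%:R - j%:R + 1) (j - 2 * i) *
    poch ((j - 2 * i)%N%:R + 1) i / i`!%:R.
Proof.
move=> ij; rewrite /mac_coef.
have bE : ('C(j - i, i) * (i`! * (j - 2 * i)`!) = (j - i)`!)%N.
  have -> : (j - 2 * i = (j - i) - i)%N by lia.
  by apply: bin_fact; lia.
have pE := poch_nat R (j - 2 * i) i.
have jiE : (j - 2 * i + i = j - i)%N by lia.
rewrite jiE -bE !natrM in pE.
have f0 k : k`!%:R != 0 :> R by rewrite pnatr_eq0 -lt0n fact_gt0.
have : poch ((j - 2 * i)%N%:R + 1) i = 'C(j - i, i)%:R * i`!%:R :> R.
  by apply: (mulfI (f0 (j - 2 * i)%N)); rewrite pE; ring.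
by move=> ->; have := f0 i => i0; field.
Qed.

Lemma mac_coef_rec0 nu j :
  mac_coef nu j.+2 0 = (nu - j.+1%:R) * mac_coef nu j.+1 0.
Proof.
rewrite /mac_coef !bin0 !mul1r !muln0 !subn0 pochSl; congr (_ * poch _ _).
  by rewrite -[j.+2%:R]natr1; ring.
by rewrite -[j.+2%:R]natr1; ring.
Qed.

(** Generically this is Pascal's rule together with [(i+1) 'C(j-i, i+1) = (j-2i) 'C(j-i, i)]. Below
    [j = 2 i] all terms vanish, and at [j = 2 i] the subtracted one does. *)
Lemma mac_coef_rec nu j i :
  mac_coef nu j.+2 i.+1 - (nu - j.+1%:R) * mac_coef nu j.+1 i.+1 = mac_coef nu j i.
Proof.
case: (ltngtP j (2 * i)) => [ji|ji|ji].
- by rewrite !mac_coef_eq0 ?mulr0 ?subr0//; lia.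
- rewrite /mac_coef.
  have [M jE] : exists M, (j = 2 * i + M.+1)%N by exists (j - 2 * i).-1; lia.
  rewrite (_ : j.+2 - i.+1 = (j - i).+1)%N; last by lia.
  rewrite (_ : j.+1 - i.+1 = j - i)%N; last by lia.
  rewrite (_ : j.+2 - 2 * i.+1 = M.+1)%N; last by lia.
  rewrite (_ : j.+1 - 2 * i.+1 = M)%N; last by lia.
  rewrite (_ : j - 2 * i = M.+1)%N; last by lia.
  rewrite pochSl pochSr binS natrD.
  have -> : nu + i.+1%:R - j.+2%:R + 1 + 1 = nu + i%:R - j%:R + 1 :> R.
    by rewrite -!natr1; ring.
  have -> : nu + i.+1%:R - j.+1%:R + 1 = nu + i%:R - j%:R + 1 :> R.
    by rewrite -!natr1; ring.
  have bE : i.+1%:R * 'C(j - i, i.+1)%:R = (j%:R - i%:R - i%:R) * 'C(j - i, i)%:R :> R.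
    have -> : j%:R - i%:R - i%:R = (j - i - i)%:R :> R.
      by rewrite !natrB //; lia.
    by rewrite -!natrM; congr (_%:R); rewrite mul_bin_left.
  have jE' : j%:R = i%:R + i%:R + M%:R + 1 :> R.
    by rewrite jE natrD -natr1 mul2n -addnn natrD; ring.
  have {}bE : 'C(j - i, i.+1)%:R * (i%:R + 1) =
     (M%:R + 1) * 'C(j - i, i)%:R :> R.
    by rewrite mulrC natr1 bE jE'; ring.
  rewrite -!natr1 jE'.
  set p := poch _ _; set C1 : R := 'C(_, i)%:R; set C2 : R := 'C(_, _)%:R in bE *.
  transitivity (p * (C2 * (i%:R + 1) + C1 * (nu - i%:R - M%:R - 1))).
    by ring.
  by rewrite bE -/C1; ring.
- rewrite /mac_coef.
  have -> : (j - i = i)%N by lia.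
  have -> : (j.+2 - i.+1 = i.+1)%N by lia.
  have -> : (j.+1 - i.+1 = i)%N by lia.
  rewrite (_ : j.+2 - 2 * i.+1 = 0)%N; last by lia.
  rewrite (_ : j - 2 * i = 0)%N; last by lia.
  by rewrite !binn bin_small// !poch0 mul0r mulr0 subr0.
Qed.

Definition mac nu x j : R := (-1) ^+ j * \sum_(i < j.+1) mac_coef nu j i * x ^+ i.

Lemma macE nu x j N : (j <= N)%N ->
  mac nu x j = (-1) ^+ j * \sum_(i < N.+1) mac_coef nu j i * x ^+ i.
Proof.
move=> jN; rewrite /mac; congr (_ * _).
rewrite -(subnKC jN) -addSn big_split_ord /= [X in _ + X]big1 ?addr0// => i _.
by rewrite mac_coef_eq0 ?mul0r//; lia.
Qed.

(** The sequence [x^j rho_(nu-j)(x)] satisfies the same recurrence, a rewriting of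
    [rho_(a+1) = a rho_a + x rho_(a-1)]; [mac] is the solution with initial values [1] and
    [- nu]. *)
Lemma mac_rec nu x j :
  mac nu x j.+2 + (nu - j.+1%:R) * mac nu x j.+1 = x * mac nu x j.
Proof.
rewrite (@macE nu x j.+1 j.+2)// (@macE nu x j j.+1)// /mac !exprS.
rewrite big_ord_recl [X in _ + _ * (_ * X)]big_ord_recl /= mac_coef_rec0.
have -> : \sum_(i < j.+2) mac_coef nu j i * x ^+ i =
  \sum_(i < j.+2) mac_coef nu j.+2 (bump 0 i) * x ^+ i
  - (nu - j.+1%:R) * \sum_(i < j.+2) mac_coef nu j.+1 (bump 0 i) * x ^+ i.
  rewrite mulr_sumr -sumrB; apply: eq_bigr => i _.
  by rewrite -mac_coef_rec /bump /= add1n; ring.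
have shift k : \sum_(i < j.+2) mac_coef nu k (bump 0 i) * x ^+ bump 0 i =
   x * \sum_(i < j.+2) mac_coef nu k (bump 0 i) * x ^+ i.
  by rewrite mulr_sumr; apply: eq_bigr => i _; rewrite /bump /= add1n exprS; ring.
by rewrite !shift !expr0 !mulr1; ring.
Qed.

Lemma mac0 nu x : mac nu x 0 = 1.
Proof. by rewrite /mac big_ord1 /mac_coef poch0 bin0 !mulr1. Qed.

Lemma mac1 nu x : mac nu x 1 = - nu.
Proof.
rewrite /mac big_ord_recl big_ord1 /= [mac_coef _ _ (bump _ _)]mac_coef_eq0//.
by rewrite /mac_coef pochSl poch0 bin0; ring.
Qed.

End Macdonald_recurrence.

(** * Expansion of [x^r Y_0] along a solution of the recurrence *)

Section Laguerre_expansion.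
Variables (R : numFieldType).
Implicit Types (nu x : R) (Y : nat -> R).

(** Multiplication by [x] replaces [Y_j] by [Y_(j+2) + (nu - j - 1) Y_(j+1)]; the clauses collect
    the coefficient of each [Y_j] after [r] such steps from [Y_0]. *)
Fixpoint lag_coef nu (r j : nat) : R :=
  match r, j with
  | 0%N, j => (j == 0%N)%:R
  | r.+1, 0%N => 0
  | r.+1, 1%N => (nu - 1) * lag_coef nu r 0
  | r.+1, j.+2 => lag_coef nu r j + (nu - j.+2%:R) * lag_coef nu r j.+1
  end.

Lemma lag_coef_eq0 nu r j : (2 * r < j)%N -> lag_coef nu r j = 0.
Proof.
elim: r j => [[]//|r IH [|[|j]]] /= rj; [lia|lia|].
by rewrite !IH ?mulr0 ?addr0//; lia.
Qed.

Lemma lag_coef_sum nu x Y r N :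
    (forall j, Y j.+2 + (nu - j.+1%:R) * Y j.+1 = x * Y j) -> (2 * r <= N)%N ->
  \sum_(j < N.+1) lag_coef nu r j * Y j = x ^+ r * Y 0%N.
Proof.
move=> HY; elim: r N => [|r IH] N rN.
  by rewrite big_ord_recl big1 ?addr0 /= ?mul1r// => i _; rewrite mul0r.
case: N rN => [|[|N]]; [lia|lia|] => rN.
rewrite exprS -mulrA -(IH N) ?mulr_sumr; last by lia.
rewrite 2!big_ord_recl [lag_coef _ _ (lift _ _)]/= [lag_coef _ _ ord0]/= mul0r add0r.
have -> : \sum_(i < N.+1) lag_coef nu r.+1 (lift ord0 (lift ord0 i)) *
    Y (lift ord0 (lift ord0 i)) = \sum_(i < N.+1) lag_coef nu r i * Y i.+2 +
    \sum_(i < N.+1) (nu - i.+2%:R) * lag_coef nu r i.+1 * Y i.+2.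
  by rewrite -big_split; apply: eq_bigr => i _ /=; ring.
rewrite addrCA.
have -> : (nu - 1) * lag_coef nu r 0 * Y (lift ord0 (ord0 : 'I_N.+2)) +
   \sum_(i < N.+1) (nu - i.+2%:R) * lag_coef nu r i.+1 * Y i.+2 =
   \sum_(i < N.+2) (nu - i.+1%:R) * lag_coef nu r i * Y i.+1.
  by rewrite [RHS]big_ord_recl.
rewrite [X in _ + X]big_ord_recr /= (@lag_coef_eq0 _ _ N.+1) ?mulr0 ?mul0r ?addr0; last by lia.
rewrite -big_split; apply: eq_bigr => i _ /=.
by rewrite mulrCA -HY; ring.
Qed.

(** Let [U_r(i) = (nu-i)_r (-i)_r]. Since [U_(r+1)(0) = 0] and
    [U_(r+1)(i+1) = (i+1-nu) (i+1) U_r(i)], raising [r] shifts the sum by one. For target index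
    [j+2], the splitting [nu - i - 1 = (nu - j - 2) + (j + 1 - i)] then yields the two terms of the
    recursion. *)
Lemma lag_coefE nu r j :
  lag_coef nu r j = \sum_(i < j.+1)
     (-1) ^+ i / (i`!%:R * (j - i)`!%:R) * (poch (nu - i%:R) r * poch (- i%:R) r).
Proof.
have f0 k : k`!%:R != 0 :> R by rewrite pnatr_eq0 -lt0n fact_gt0.
elim: r j => [|r IH] j.
  have [->|j0] := eqVneq j 0%N.
    by rewrite big_ord1 /= !poch0 !fact0 expr0; field.
  rewrite /= (negbTE j0).
  (* For [r = 0] and [j > 0] the sum is [(1 - 1)^j / j!]. *)
  have := exprDn (1 : R) (-1) j; rewrite subrr expr0n (negbTE j0) => /(congr1 (fun t => j`!%:R^-1 * t)).
  rewrite mulr0 mulr_sumr => H; apply: (etrans H); apply: eq_bigr => i _.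
  rewrite !poch0 expr1n mul1r -mulr_natr !mulr1.
  have ij : (i <= j)%N by rewrite -ltnS.
  have := bin_fact ij => /(congr1 (fun k => k%:R : R)); rewrite !natrM => E.
  rewrite -[j`!%:R in LHS]E.
  have := f0 i; have := f0 (j - i)%N => ? ?.
  have : 'C(j, i)%:R != 0 :> R by rewrite pnatr_eq0 -lt0n bin_gt0.
  by move=> ?; field; apply/and3P.
have US i : poch (nu - i.+1%:R) r.+1 * poch (- i.+1%:R) r.+1 =
   (i.+1%:R - nu) * i.+1%:R * (poch (nu - i%:R) r * poch (- i%:R) r).
  rewrite !pochSl (_ : nu - i.+1%:R + 1 = nu - i%:R); last by rewrite -natr1; ring.
  by rewrite (_ : - i.+1%:R + 1 = - i%:R); [ring|rewrite -natr1; ring].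
have U0 : poch (nu - 0%:R) r.+1 * poch (- 0%:R) r.+1 = 0.
  by rewrite [X in _ * X]pochSl oppr0 mul0r mulr0.
rewrite big_ord_recl U0 mulr0 add0r.
case: j => [|j]; first by rewrite big_ord0.
have -> : \sum_(i < j.+1) (-1) ^+ lift ord0 i / ((lift ord0 i)`!%:R * (j.+1 - lift ord0 i)`!%:R) *
    (poch (nu - (lift ord0 i)%:R) r.+1 * poch (- (lift ord0 i)%:R) r.+1) =
  \sum_(i < j.+1) (-1) ^+ i / (i`!%:R * (j - i)`!%:R) * (nu - i.+1%:R) *
    (poch (nu - i%:R) r * poch (- i%:R) r).
  apply: eq_bigr => i _; rewrite /= US /bump /= add1n subSS factS natrM exprS.
  have := f0 i; have := f0 (j - i)%N.
  have : i.+1%:R != 0 :> R by rewrite pnatr_eq0.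
  by move=> ? ? ?; field; rewrite nat1r; apply/and3P.
case: j => [|j] /=; rewrite !IH.
  by rewrite !big_ord1 /= ; ring.
rewrite mulr_sumr [X in _ + X]big_ord_recr [RHS]big_ord_recr addrA -big_split /=; congr (_ + _).
  apply: eq_bigr => i _; rewrite /= subSn -1?ltnS// factS natrM.
  have ji : (j - i).+1%:R = j.+2%:R - i.+1%:R :> R.
    by rewrite -subSn -1?ltnS// -natrB// ltnS ltnW.
  have := f0 i; have := f0 (j - i)%N.
  have : (j - i).+1%:R != 0 :> R by rewrite pnatr_eq0.
  rewrite -[nu - i.+1%:R](subrK (nu - j.+2%:R)) (_ : nu - i.+1%:R - (nu - j.+2%:R) = (j - i).+1%:R); last first.
    by rewrite ji; ring.
  by move=> ? ? ?; field; rewrite nat1r; apply/and3P.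
by ring.
Qed.

End Laguerre_expansion.

(** * Iterated differences of polynomials and Newton's formula *)

Section Backward_differences.
Variable R : numFieldType.
Implicit Types (p q : {poly R}) (y : R).

(** The sign is that of [1 - E], with [E] the shift by 1, so that the iterates carry the signs
    [(-1)^i] produced by [(-k)_i]. *)
Definition bdiff p := p - (p \Po ('X + 1%:P)).

Lemma bdiff_eval p y : (bdiff p).[y] = p.[y] - p.[y + 1].
Proof. by rewrite /bdiff !hornerE horner_comp !hornerE. Qed.

Lemma size_bdiff p : (size (bdiff p) <= (size p).-1)%N.
Proof.
rewrite /bdiff -{1}[p]coefK comp_polyE poly_def -sumrB.
apply: (leq_trans (size_sum _ _ _)); apply/bigmax_leqP => i _.
rewrite -scalerBr (leq_trans (size_scale_leq _ _))//.
rewrite subrXX (_ : 'X - ('X + 1%:P) = (- 1)%:P :> {poly R}); last by rewrite polyCN; ring.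
rewrite mul_polyC (leq_trans (size_scale_leq _ _))//.
apply: (leq_trans (size_sum _ _ _)); apply/bigmax_leqP => k _.
rewrite (leq_trans (size_polyMleq _ _))// size_polyXn.
have -> : ('X + 1%:P : {poly R}) = 'X - (- 1)%:P by rewrite polyCN opprK.
rewrite size_exp_XsubC.
by case: k => k ki; case: i ki => i isz /=; case: (size p) isz => //; lia.
Qed.

Lemma size_iter_bdiff p k : (size (iter k bdiff p) <= size p - k)%N.
Proof.
elim: k => [|k IH] /=; first by rewrite subn0.
by rewrite (leq_trans (size_bdiff _))// subnS -!subn1 leq_sub2r.
Qed.

Lemma iter_bdiff_eq0 p k : (size p <= k)%N -> iter k bdiff p = 0.
Proof.
by move=> pk; apply/eqP; rewrite -size_poly_leq0 (leq_trans (size_iter_bdiff _ _))// leqn0 subn_eq0.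
Qed.

Lemma iter_bdiff_eval p k y :
  (iter k bdiff p).[y] = \sum_(i < k.+1) (-1) ^+ i * 'C(k, i)%:R * p.[y + i%:R].
Proof.
elim: k y => [|k IH] y /=; first by rewrite big_ord1 /= bin0 addr0 expr0 !mul1r.
rewrite bdiff_eval !IH big_ord_recl [RHS]big_ord_recl /= !bin0 -addrA; congr (_ + _).
transitivity (\sum_(i < k.+1) (-1) ^+ i.+1 * 'C(k, i.+1)%:R * p.[y + i.+1%:R] -
  \sum_(i < k.+1) (-1) ^+ i * 'C(k, i)%:R * p.[y + 1 + i%:R]).
  by rewrite [in RHS]big_ord_recr /= bin_small// mulr0 mul0r addr0.
rewrite -sumrB; apply: eq_bigr => i _; rewrite /bump /= add1n binS natrD exprS.
by rewrite -addrA nat1r; ring.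
Qed.

(** With [D = 1 - E], nilpotent on polynomials of bounded degree, [\sum_k 'C(k, j) D^k = D^j (1 -
    D)^(-j-1) = D^j E^(-j-1)]. The proof moves one shift at a time onto [p']: the case [j = 0]
    telescopes, and summation by parts with Pascal's rule lowers [j]. *)
Lemma sum_bin_bdiff p N j : (size p <= N.+1)%N ->
  \sum_(k < N.+1) 'C(k, j)%:R * (iter k bdiff p).[0] =
  (iter j bdiff p).[- 1 - j%:R].
Proof.
elim: j p => [|j IH] p pN; set p' := p \Po ('X - 1%:P).
all: have p'E y : p'.[y + 1] = p.[y] by rewrite /p' horner_comp !hornerE addrK.
all: have sp' : (size p' <= N.+1)%N.
all: try by rewrite /p' size_comp_poly2// size_XsubC.
all: have shift k : (iter k bdiff p).[0] = (iter k bdiff p').[0] - (iter k.+1 bdiff p').[0].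
all: try by rewrite iterS bdiff_eval subKr !iter_bdiff_eval; apply: eq_bigr => i _; rewrite -(p'E (0 + i%:R)) addrAC.
all: under eq_bigr do rewrite shift.
  under eq_bigr do rewrite bin0 mul1r.
  have := telescope_sumr (fun k => - (iter k bdiff p').[0]) (leq0n N.+1).
  rewrite big_mkord (iter_bdiff_eq0 sp') horner0 oppr0 sub0r opprK => E.
  rewrite addr0 /= -p'E addNr -[RHS]E.
  by apply: eq_bigr => i _; rewrite addrC opprK.
have := telescope_sumr (fun k => - ('C(k, j.+1)%:R * (iter k bdiff p').[0])) (leq0n N.+1).
rewrite big_mkord (iter_bdiff_eq0 sp') horner0 mulr0 oppr0 sub0r opprK bin_small// mul0r => E.
transitivity (\sum_(k < N.+1) 'C(k, j)%:R * (iter k bdiff (bdiff p')).[0]).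
  apply/eqP; rewrite -subr_eq0 -sumrB -[X in _ == X]E; apply/eqP/eq_bigr => i _.
  by rewrite -iterSr binS natrD /=; ring.
rewrite IH; last by rewrite (leq_trans (size_bdiff _))// -subn1 leq_subLR (leq_trans sp').
rewrite -iterSr !iter_bdiff_eval; apply: eq_bigr => i _; congr (_ * _).
by rewrite -p'E; congr (_.[_]); rewrite -natr1; ring.
Qed.

End Backward_differences.

(** * The Laguerre-type double sum for a single power of [x] *)

Section Expansion.
Variable R : numFieldType.
Implicit Types (nu x : R) (Y : nat -> R).

Definition pochp (a : R) r : {poly R} := \prod_(i < r) ('X - (- (a + i%:R))%:P).

Lemma pochp_eval a r y : (pochp a r).[y] = poch (a + y) r.
Proof.
rewrite /pochp /poch horner_prod; apply: eq_bigr => i _.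
by rewrite !hornerE; ring.
Qed.

(** Its degree [2 * r] is the reason why the sums over [k] stop at [2 * n]. *)
Definition tpoly nu r : {poly R} := pochp (1 + nu) r * pochp 1 r.

Lemma size_tpoly nu r : (size (tpoly nu r) <= (2 * r).+1)%N.
Proof.
have sz a : size (pochp a r) = r.+1.
  by rewrite /pochp -big_enum size_prod_XsubC size_enum_ord.
by rewrite (leq_trans (size_polyMleq _ _))// !sz; lia.
Qed.

(** The factorials combine to ['C(k, j) / j!], so after exchanging the sums the inner one is
    Newton's. In the resulting difference at [-1-j], reversing the index moves the nodes to [-1-i],
    where [tpoly] takes the value [(nu-i)_r (-i)_r] of [lag_coefE]. *)
Lemma laguerre_sum nu x Y r N :
    (forall j, Y j.+2 + (nu - j.+1%:R) * Y j.+1 = x * Y j) -> (2 * r <= N)%N ->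
  \sum_(k < N.+1) \sum_(j < k.+1)
    (-1) ^+ j * (k`!%:R / j`!%:R) * (iter k (@bdiff R) (tpoly nu r)).[0] /
      (j`!%:R * (k - j)%N`!%:R) * Y j = x ^+ r * Y 0%N.
Proof.
move=> HY rN; rewrite -(lag_coef_sum HY rN).
have f0 k : k`!%:R != 0 :> R by rewrite pnatr_eq0 -lt0n fact_gt0.
transitivity (\sum_(k < N.+1) \sum_(j < N.+1) (-1) ^+ j / j`!%:R * Y j *
    ('C(k, j)%:R * (iter k (@bdiff R) (tpoly nu r)).[0])).
  apply: eq_bigr => k _.
  have kN : (k <= N)%N by rewrite -ltnS.
  move: (nat_of_ord k) kN => {}k kN.
  rewrite -(subnKC kN) -addSn big_split_ord /= [X in _ = _ + X]big1 ?addr0 => [|i _]; last first.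
    by rewrite bin_small ?mul0r ?mulr0//; lia.
  apply: eq_bigr => j _ /=.
  have jk : (j <= k)%N by rewrite -ltnS.
  have := bin_fact jk => /(congr1 (fun k => k%:R : R)); rewrite !natrM => <-.
  have := f0 j; have := f0 (k - j)%N => ? ?.
  by field; apply/andP.
rewrite exchange_big /=; apply: eq_bigr => j _.
rewrite -mulr_sumr sum_bin_bdiff; last first.
  by rewrite (leq_trans (size_tpoly _ _)).
rewrite lag_coefE iter_bdiff_eval [in RHS]mulrC mulr_sumr [in RHS]mulr_sumr.
rewrite (reindex_inj rev_ord_inj); apply: eq_bigr => i _ /=.
have ij : (i <= j)%N by rewrite -ltnS.
rewrite subSS bin_sub// hornerM !pochp_eval.
have -> : - 1 - j%:R + (j - i)%:R = - 1 - i%:R :> R by rewrite natrB//; ring.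
rewrite (_ : 1 + nu + _ = nu - i%:R); last by ring.
rewrite (_ : 1 + _ = - i%:R); last by ring.
have := bin_fact ij => /(congr1 (fun k => k%:R : R)); rewrite !natrM => E.
have -> : (-1) ^+ i = (-1) ^+ j * (-1) ^+ (j - i) :> R.
  rewrite -exprD (_ : j + (j - i) = i + 2 * (j - i))%N; last by lia.
  by rewrite exprD exprM sqrrN !expr1n mulr1.
have := f0 i; have := f0 (j - i)%N => ? ?.
have C0 : 'C(j, i)%:R != 0 :> R by rewrite pnatr_eq0 -lt0n bin_gt0.
by rewrite -E; field; apply/and3P.
Qed.

End Expansion.

(** * Tonelli, scaling and power integrals on the open half-line *)

Section Half_line.
Variable R : realType.
Notation mu := (@lebesgue_measure R).
Local Notation RR := (measurableTypeR R * measurableTypeR R)%type.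
Local Notation D0 := (`]0, +oo[%classic : set R).

Lemma in_half_line (x : R) : D0 x -> 0 < x.
Proof. by rewrite /= in_itv /= andbT. Qed.

(** Extension by zero: Tonelli is applied on the whole plane, while the integrands are assumed
    nonnegative only on the open quadrant. *)
Let cut (f : RR -> R) z : R := f z * \1_D0 z.1 * \1_D0 z.2.

Let measurable_cut f : measurable_fun [set: RR] f -> measurable_fun [set: RR] (EFin \o cut f).
Proof.
move=> mf; apply/measurable_EFinP; apply: measurable_funM; first apply: measurable_funM => //.
- by apply: (measurableT_comp (measurable_indic _)) => //.
- by apply: (measurableT_comp (measurable_indic _)) => //.
Qed.

Let cut_ge0 f : (forall x y, 0 < x -> 0 < y -> 0 <= f (x, y)) ->
  forall z, (0 <= (EFin \o cut f) z)%E.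
Proof.
move=> f0 [x y]; rewrite lee_fin /cut !indicE /=.
have [/set_mem/in_half_line x0|_] := boolP (x \in D0); last by rewrite mulr0 mul0r.
have [/set_mem/in_half_line y0|_] := boolP (y \in D0); last by rewrite mulr0.
by rewrite !mulr1 f0.
Qed.

Let cut1E (f : RR -> R) x :
  fubini_F mu (EFin \o cut f) x = ((fun x => \int[mu]_(y in D0) (f (x, y))%:E) \_ D0)%E x.
Proof.
rewrite /fubini_F patchE; case: ifPn => xD; last first.
  by apply: integral0_eq => y _; rewrite /cut /= !indicE (negbTE xD) mulr0 mul0r.
rewrite [RHS]integral_mkcond; apply: eq_integral => y _.
rewrite patchE /cut /= !indicE xD mulr1.
by case: (y \in D0); rewrite ?mulr1 ?mulr0.
Qed.

Let cut2E (f : RR -> R) y :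
  fubini_G mu (EFin \o cut f) y = ((fun y => \int[mu]_(x in D0) (f (x, y))%:E) \_ D0)%E y.
Proof.
rewrite /fubini_G patchE; case: ifPn => xD; last first.
  by apply: integral0_eq => x _; rewrite /cut /= !indicE (negbTE xD) mulr0.
rewrite [RHS]integral_mkcond; apply: eq_integral => x _.
rewrite patchE /cut /= !indicE xD mulr1.
by case: (x \in D0); rewrite ?mulr1 ?mulr0.
Qed.

Lemma half_line_tonelli (f : RR -> R) : measurable_fun [set: RR] f ->
  (forall x y, 0 < x -> 0 < y -> 0 <= f (x, y)) ->
  (\int[mu]_(x in D0) \int[mu]_(y in D0) (f (x, y))%:E =
   \int[mu]_(y in D0) \int[mu]_(x in D0) (f (x, y))%:E)%E.
Proof.
move=> mf f0; rewrite [LHS]integral_mkcond [RHS]integral_mkcond.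
under eq_integral do rewrite -cut1E; under [RHS]eq_integral do rewrite -cut2E.
by apply: fubini_tonelli; [exact: measurable_cut|exact: cut_ge0].
Qed.

Lemma measurable_half_line_integral (f : RR -> R) : measurable_fun [set: RR] f ->
  (forall x y, 0 < x -> 0 < y -> 0 <= f (x, y)) ->
  measurable_fun D0 (fun x => \int[mu]_(y in D0) (f (x, y))%:E)%E.
Proof.
move=> mf f0; apply/(measurable_restrictT (fun x => \int[mu]_(y in D0) (f (x, y))%:E)%E) => //.
rewrite -(funext (cut1E f)).
by apply: measurable_fun_fubini_tonelli_F; [exact: measurable_cut|exact: cut_ge0].
Qed.

(** Closed rays avoid a possible singularity at 0. The free constant [c] makes the rays for [c] the
    images of those for 1 under [x -> c x]. *)
Lemma half_line_cvg (c : R) (f : R -> R) : 0 < c ->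
  measurable_fun D0 f -> (forall x, 0 < x -> 0 <= f x) ->
  (\int[mu]_(x in `[(c / n.+1%:R)%R, +oo[) (f x)%:E @[n --> \oo] -->
   \int[mu]_(x in D0) (f x)%:E)%E.
Proof.
move=> c0 mf f0.
have cn n : 0 < c / n.+1%:R by rewrite divr_gt0.
have DE : D0 = \bigcup_n `[(c / n.+1%:R), +oo[%classic.
  apply/seteqP; split=> x.
    move=> /in_half_line x0; exists (Num.trunc (c / x)) => //=.
    rewrite in_itv /= andbT ler_pdivrMr// mulrC -ler_pdivrMr//.
    by rewrite ltW// truncnS_gt.
  by move=> [n _] /=; rewrite !in_itv/= !andbT; exact: lt_le_trans.
rewrite DE; apply: ge0_nondecreasing_set_cvg_integral => //.
- move=> m n mn; rewrite subsetEset; apply: subset_itvr.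
  by rewrite bnd_simp ler_pM2l// lef_pV2 ?posrE// ler_nat ltnS.
- move=> n; apply/measurable_EFinP; apply: measurable_funS mf => //.
  by move=> x /=; rewrite !in_itv/= !andbT; exact: lt_le_trans.
- by move=> n x /=; rewrite in_itv/= andbT lee_fin => /(lt_le_trans (cn n))/f0.
Qed.

Lemma half_line_scale (c : R) (f : R -> R) : 0 < c ->
  {in D0, continuous f} -> (forall x, 0 < x -> 0 <= f x) ->
  (\int[mu]_(x in D0) (f x)%:E = c%:E * \int[mu]_(x in D0) (f (c * x))%:E)%E.
Proof.
move=> c0 cf f0.
have mf : measurable_fun D0 f.
  by apply: open_continuous_measurable_fun => //; exact: interval_open.
have cfc : {in D0, continuous (fun x => f (c * x))}.
  move=> x /set_mem /in_half_line x0; apply: continuous_comp.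
    by apply: (@cvgMl_tmp R R); exact: cvg_id.
  by apply: cf; rewrite inE /= in_itv /= andbT mulr_gt0.
have mfc : measurable_fun D0 (fun x => f (c * x)).
  by apply: open_continuous_measurable_fun => //; exact: interval_open.
have l1 := half_line_cvg c0 mf f0.
have l2 : (\int[mu]_(x in `[(c / n.+1%:R)%R, +oo[) (f x)%:E @[n --> \oo] -->
     c%:E * \int[mu]_(x in D0) (f (c * x))%:E)%E.
  have l3 := @half_line_cvg 1 (fun x => f (c * x)) ltr01 mfc
    (fun x x0 => f0 _ (mulr_gt0 c0 x0)).
  have /= l4 := cvgeZl (erefl : c%:E \is a fin_num) l3.
  apply: cvg_trans l4; apply: near_eq_cvg; near=> n.
  rewrite -ge0_integralZl//=; last 3 first.
  - by apply/measurable_EFinP; apply: measurable_funS mfc => // x /=; rewrite !in_itv/= !andbT; apply: lt_le_trans; rewrite divr_gt0.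
  - move=> x /=; rewrite in_itv /= andbT => xn; rewrite lee_fin f0// mulr_gt0//.
    by rewrite (lt_le_trans _ xn)// divr_gt0.
  - by rewrite lee_fin ltW.
  have -> : c / n.+1%:R = c * (1 / n.+1%:R) by rewrite mul1r.
  have F'E : derive1 (fun x : R => c * x) = cst c.
    by apply/funext => x; rewrite derive1Ml// derive1_id mulr1.
  rewrite (@increasing_ge0_integration_by_substitutiony R (fun x => c * x) f (1 / n.+1%:R)).
  - by apply: eq_integral => x _; rewrite F'E /= -EFinM mulrC.
  - by move=> x y _ _ xy; rewrite ltr_pM2l.
  - by rewrite F'E => x _; exact: cst_continuous.
  - by rewrite F'E; exact: is_cvg_cst.
  - by rewrite F'E; exact: is_cvg_cst.
  - split; first by move=> x _; exact: derivableM.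
    by apply: cvg_at_right_filter; apply: (@cvgMl_tmp R R); exact: cvg_id.
  - by apply: gt0_cvgMry => //.
  - apply: continuous_in_subspaceT => x /set_mem /=; rewrite in_itv/= andbT => xn.
    by apply: cf; rewrite inE /= in_itv/= andbT (lt_le_trans _ xn)// mulr_gt0 ?divr_gt0.
  - move=> x; rewrite in_itv/= andbT => xn; apply: f0.
    by rewrite (lt_trans _ xn)// mulr_gt0 ?divr_gt0.
by rewrite -(cvg_lim (@ereal_hausdorff _) l1) (cvg_lim (@ereal_hausdorff _) l2).
Unshelve. all: by end_near. Qed.

(** For [a < 1] the integrand is unbounded at 0, so the fundamental theorem is used on
    [[s/(n+1), s]] and [n] tends to infinity. *)
Lemma integral_powR (a s : R) : 0 < a -> 0 < s ->
  (\int[mu]_(x in `]0%R, s]) (a * x `^ (a - 1))%:E = (s `^ a)%:E)%E.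
Proof.
move=> a0 s0.
pose f x := a * x `^ (a - 1).
have sn n : 0 < s / n.+1%:R by rewrite divr_gt0.
have DE : `]0, s]%classic = \bigcup_n `[(s / n.+1%:R), s]%classic.
  apply/seteqP; split=> x /=.
    rewrite in_itv /= => /andP[x0 xs]; exists (Num.trunc (s / x)) => //=.
    rewrite in_itv /= xs andbT ler_pdivrMr// mulrC -ler_pdivrMr//.
    by rewrite ltW// truncnS_gt.
  by move=> [n _] /=; rewrite !in_itv/= => /andP[/(lt_le_trans (sn n)) -> ->].
have mf : measurable_fun setT f.
  by apply: measurable_funM => //; exact: measurable_powR.
have l1 : (\int[mu]_(x in `[(s / n.+1%:R)%R, s]) (f x)%:E @[n --> \oo] -->
    \int[mu]_(x in `]0%R, s]) (f x)%:E)%E.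
  rewrite DE; apply: ge0_nondecreasing_set_cvg_integral => //.
  - move=> m n mn; rewrite subsetEset; apply: subset_itvr.
    by rewrite bnd_simp ler_pM2l// lef_pV2 ?posrE// ler_nat ltnS.
  - by move=> n; apply/measurable_EFinP; apply: measurable_funS mf.
  - by move=> n x _; rewrite lee_fin mulr_ge0 ?powR_ge0// ltW.
have su0 : s / n.+1%:R @[n --> \oo] --> (0 : R).
  by rewrite -(mulr0 s); apply: cvgMl_tmp; exact: cvg_harmonic.
have l0 : (s / n.+1%:R) `^ a @[n --> \oo] --> (0 : R).
  by have [+ _] := cvg_at_rightP (fun x : R => x `^ a) 0 0; apply => //; exact: powR_cvg0.
have l2 : (\int[mu]_(x in `[(s / n.+1%:R)%R, s]) (f x)%:E @[n --> \oo] --> (s `^ a)%:E)%E.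
  have l3 : ((s `^ a - (s / n.+1%:R) `^ a)%:E @[n --> \oo] --> (s `^ a)%:E)%E.
    apply: cvg_EFin; first by near=> n.
    by rewrite -[X in _ --> X]subr0; apply: cvgB => //; exact: cvg_cst.
  apply: cvg_trans l3; apply: near_eq_cvg; near=> n.
  have sns : s / n.+1%:R < s.
    by rewrite ltr_pdivrMr// ltr_pMr// ltr1n ltnS; near: n; exact: nbhs_infty_gt.
  have dp x : 0 < x -> derivable (fun y : R => y `^ a) x 1.
    by move=> x0; apply: derivable_powR; rewrite in_itv/= andbT.
  have cp p x : 0 < x -> {for x, continuous (fun y : R => y `^ p)}.
    move=> x0; apply: differentiable_continuous; apply/derivable1_diffP.
    by apply: derivable_powR; rewrite in_itv/= andbT.
  rewrite (@continuous_FTC2 R f (fun x => x `^ a))//.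
  - apply: continuous_in_subspaceT => x /set_mem /=; rewrite in_itv/= => /andP[xn _].
    apply: (@cvgMl_tmp R R); apply: cp; exact: lt_le_trans xn.
  - split.
    + by move=> x; rewrite in_itv/= => /andP[xn _]; apply: dp; exact: lt_trans xn.
    + by apply: cvg_at_right_filter; exact: cp.
    + by apply: cvg_at_left_filter; exact: cp.
  - move=> x; rewrite in_itv/= => /andP[xn _].
    by rewrite powR_derive1// in_itv/= andbT; exact: lt_trans xn.
by rewrite -(cvg_lim (@ereal_hausdorff _) l1) (cvg_lim (@ereal_hausdorff _) l2).
Unshelve. all: by end_near. Qed.

End Half_line.

(** * Functional equation, finiteness and scaling of the Gamma integral *)

Section Gamma_function.
Variable R : realType.
Notation mu := (@lebesgue_measure R).
Local Notation RR := (measurableTypeR R * measurableTypeR R)%type.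
Local Notation D0 := (`]0, +oo[%classic : set R).

Lemma half_line_integral_ge (a c : R) (f : R -> R) : 0 < a ->
  measurable_fun D0 f -> (forall x, 0 < x -> 0 <= f x) ->
  0 <= c -> (forall x, a <= x <= a + 1 -> c <= f x) ->
  (c%:E <= \int[mu]_(x in D0) (f x)%:E)%E.
Proof.
move=> a0 mf f0 c0 fc.
have sD : `[a, a + 1]%classic `<=` D0.
  by move=> x /=; rewrite !in_itv/= andbT => /andP[ax _]; exact: lt_le_trans ax.
apply: (@le_trans _ _ (\int[mu]_(x in `[a, (a + 1)%R]) (f x)%:E)%E); last first.
  apply: ge0_subset_integral => //; first exact/measurable_EFinP.
  by move=> x /in_half_line x0; rewrite lee_fin f0.
apply: (@le_trans _ _ (\int[mu]_(x in `[a, (a + 1)%R]) (cst c%:E x))%E).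
  rewrite integral_cst//= lebesgue_measure_itv/= lte_fin ltrDl ltr01.
  by rewrite -EFinB -EFinM addrAC subrr add0r mulr1.
apply: ge0_le_integral => //.
apply/measurable_EFinP; exact: measurable_funS mf.
Qed.

Lemma integral_expRN (y : R) : (\int[mu]_(s in `[y, +oo[) (expR (- s))%:E = (expR (- y))%:E)%E.
Proof.
have cN : continuous (fun s : R => expR (- s)).
  move=> s; apply: continuous_comp; last exact: continuous_expR.
  exact: opp_continuous.
rewrite (@ge0_continuous_FTC2y R _ (fun s => - expR (- s)) y 0).
- by rewrite sub0e EFinN oppeK.
- by move=> x _; exact: expR_ge0.
- exact: continuous_subspaceT.
- by rewrite -oppr0; apply: cvgN; exact: cvgr_expR.
- by move=> x _; exact: ex_derive.
- by apply: cvg_at_right_filter; apply: cvgN; exact: cN.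
- move=> x _; rewrite derive1E derive_val.
  by rewrite /GRing.scale /=; ring.
Qed.

Local Notation eGamma a := (\int[mu]_(t in D0) (t `^ (a - 1) * expR (- t))%:E)%E.

Lemma measurable_expRN : measurable_fun [set: R] (fun t : R => expR (- t)).
Proof. by apply: measurableT_comp => //; exact: measurableT_comp. Qed.

Lemma measurable_Gamma_integrand (a : R) :
  measurable_fun [set: R] (fun t => t `^ a * expR (- t)).
Proof.
apply: measurable_funM; [exact: measurable_powR|exact: measurable_expRN].
Qed.

(** Both sides integrate [a t^(a-1) e^(-s)] over the region [0 < t <= s], in the two orders. The
    identity holds in extended reals, before finiteness is known. *)
Lemma eGamma_rec (a : R) : 0 < a -> (eGamma (a + 1) = a%:E * eGamma a)%E.
Proof.
move=> a0.
pose f (z : RR) : R := if z.1 <= z.2 then a * z.1 `^ (a - 1) * expR (- z.2) else 0.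
have mf : measurable_fun [set: RR] f.
  apply: measurable_fun_ifT => //.
  - by apply: measurable_fun_ler.
  - apply: measurable_funM; last first.
      by apply: (measurableT_comp measurable_expRN).
    apply: measurable_funM => //.
    by apply: (measurableT_comp (measurable_powR (a - 1))); exact: measurable_fst.
have f0 x y : 0 < x -> 0 < y -> 0 <= f (x, y).
  by move=> x0 y0; rewrite /f /=; case: ifPn => // _; rewrite !mulr_ge0 ?expR_ge0 ?powR_ge0 ?ltW.
have := half_line_tonelli mf f0.
have -> : (\int[mu]_(x in D0) \int[mu]_(y in D0) (f (x, y))%:E = a%:E * eGamma a)%E.
  rewrite -ge0_integralZl//=; last 3 first.
  - by apply/measurable_EFinP; apply: measurable_funTS; exact: measurable_Gamma_integrand.
  - by move=> x _; rewrite lee_fin mulr_ge0 ?powR_ge0 ?expR_ge0.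
  - by rewrite lee_fin ltW.
  apply: eq_integral => t /set_mem/in_half_line t0.
  rewrite -EFinM mulrA EFinM -integral_expRN -ge0_integralZl//=; last 2 first.
  - by apply/measurable_EFinP; apply: measurable_funTS; exact: measurable_expRN.
  - by rewrite lee_fin mulr_ge0 ?powR_ge0 ?ltW.
  rewrite integral_mkcond [RHS]integral_mkcond; apply: eq_integral => s _.
  rewrite !patchE /f /= !mem_setE !in_itv/= !andbT.
  case: ifPn => s0; case: ifPn => ts //.
  by rewrite (lt_le_trans t0 ts) in s0.
move=> ->.
apply: eq_integral => s /set_mem/in_half_line s0.
have mp : measurable_fun [set: R] (fun t : R => a * t `^ (a - 1)).
  by apply: measurable_funM => //; exact: measurable_powR.
have -> : s `^ (a + 1 - 1) * expR (- s) = expR (- s) * s `^ a.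
  by rewrite addrK mulrC.
rewrite EFinM -integral_powR// -ge0_integralZl//=; last 2 first.
- by apply/measurable_EFinP; exact: measurable_funTS mp.
- by move=> x _; rewrite lee_fin mulr_ge0 ?powR_ge0 ?ltW.
rewrite integral_mkcond [RHS]integral_mkcond; apply: eq_integral => t _.
rewrite !patchE /f /= !mem_setE !in_itv/= !andbT.
by case: (0 < t) => //=; case: ifP => // _; rewrite -EFinM mulrC.
Qed.

Lemma eGamma_nat n : eGamma (n%:R + 1) = n`!%:R%:E.
Proof.
elim: n => [|n IH].
  have -> : 0`!%:R = expR (- 0) :> R by rewrite oppr0 expR0.
  rewrite -integral_expRN -integral_itv_obnd_cbnd; last first.
    by apply/measurable_EFinP; apply: measurable_funTS; exact: measurable_expRN.
  by apply: eq_integral => t _; rewrite add0r subrr powRr0 mul1r.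
rewrite -natr1 eGamma_rec ?IH; last by rewrite ltr_wpDl.
by rewrite natr1 -EFinM -natrM -factS.
Qed.

(** The functional equation raises the exponent and so removes the singularity at 0; then
    [t^a <= 1 + t^n] for an integer [n >= a] bounds the integral by [0! + n!]. *)
Lemma eGamma_fin (a : R) : 0 < a -> eGamma a \is a fin_num.
Proof.
move=> a0.
have ge0 b : (0 <= eGamma b)%E.
  by apply: integral_ge0 => x _; rewrite lee_fin mulr_ge0 ?powR_ge0 ?expR_ge0.
suff : (a%:E * eGamma a < +oo)%E.
  rewrite ge0_fin_numE//; have := ge0 a; case: (eGamma a) => [r| |]// _.
    by move=> _; rewrite ltry.
  by rewrite gt0_muley ?lte_fin.
rewrite -eGamma_rec//; pose n := (Num.trunc a).+1.
have an : a <= n%:R by rewrite ltW// truncnS_gt.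
apply: (@le_lt_trans _ _ (\int[mu]_(t in D0)
   (((t `^ (0%:R + 1 - 1) * expR (- t))%:E + (t `^ (n%:R + 1 - 1) * expR (- t))%:E)))%E).
  apply: ge0_le_integral => //.
  - by move=> x _; rewrite lee_fin mulr_ge0 ?powR_ge0 ?expR_ge0.
  - by apply/measurable_EFinP; apply: measurable_funTS; exact: measurable_Gamma_integrand.
  - by apply: emeasurable_funD; apply/measurable_EFinP; apply: measurable_funTS; exact: measurable_Gamma_integrand.
  - move=> t /in_half_line t0; rewrite -EFinD lee_fin -mulrDl ler_wpM2r ?expR_ge0//.
    rewrite add0r !addrK subrr powRr0.
    have [t1|t1] := leP 1 t.
      by rewrite (le_trans (ler_powR t1 an))// lerDr.
    rewrite (@le_trans _ _ 1)// ?lerDl ?powR_ge0//.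
    by rewrite -(powRr0 t) ger_powR ?t0 ?ltW.
rewrite ge0_integralD//; first by rewrite !eGamma_nat -EFinD ltry.
- by move=> x _; rewrite lee_fin mulr_ge0 ?powR_ge0 ?expR_ge0.
- by apply/measurable_EFinP; apply: measurable_funTS; exact: measurable_Gamma_integrand.
- by move=> x _; rewrite lee_fin mulr_ge0 ?powR_ge0 ?expR_ge0.
- by apply/measurable_EFinP; apply: measurable_funTS; exact: measurable_Gamma_integrand.
Qed.

Lemma eGammaE (a : R) : 0 < a -> eGamma a = (Gamma a)%:E.
Proof. by move=> a0; rewrite /Gamma /Rintegral fineK// eGamma_fin. Qed.

Lemma Gamma_rec (a : R) : 0 < a -> Gamma (a + 1) = a * Gamma a.
Proof.
move=> a0; apply: EFin_inj.
by rewrite -eGammaE ?addr_gt0// eGamma_rec// eGammaE.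
Qed.

Lemma Gamma_gt0 (a : R) : 0 < a -> 0 < Gamma a.
Proof.
move=> a0; rewrite -lte_fin -eGammaE//.
(* On [[1, 2]] one has [t^(a-1) >= 1/t >= 1/2] and [e^(-t) >= e^(-2)]. *)
apply: (@lt_le_trans _ _ (2^-1 * expR (- 2))%:E); first by rewrite lte_fin mulr_gt0 ?expR_gt0.
apply: (@half_line_integral_ge 1) => //.
- by apply: measurable_funTS; exact: measurable_Gamma_integrand.
- by move=> x _; rewrite mulr_ge0 ?powR_ge0 ?expR_ge0.
- move=> x /andP[x1 x2]; apply: ler_pM; [by []|exact: expR_ge0| |by rewrite ler_expR lerN2; lra].
  apply: (@le_trans _ _ (x `^ (- 1))); last by apply: ler_powR => //; lra.
  by rewrite powR_inv1 ?lef_pV2 ?posrE; lra.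
Qed.

Lemma eGamma_scale (a c : R) : 0 < a -> 0 < c ->
  (\int[mu]_(t in D0) (t `^ (a - 1) * expR (- (c * t)))%:E = (Gamma a * c `^ (- a))%:E)%E.
Proof.
move=> a0 c0; rewrite EFinM -eGammaE//.
have cf : {in D0, continuous (fun t : R => t `^ (a - 1) * expR (- t))}.
  move=> t /set_mem/in_half_line t0; apply: (@continuousM _ R^o (fun t : R => t `^ (a - 1)) (fun t : R => expR (- t))).
    apply: differentiable_continuous; apply/derivable1_diffP.
    by apply: derivable_powR; rewrite in_itv/= andbT.
  apply: continuous_comp; last exact: continuous_expR.
  exact: opp_continuous.
rewrite (half_line_scale c0 cf); last by move=> x _; rewrite mulr_ge0 ?powR_ge0 ?expR_ge0.
rewrite muleC muleA -EFinM -ge0_integralZl//=.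
- apply: eq_integral => t /set_mem/in_half_line t0.
  have E : c * c `^ (- a) * c `^ (a - 1) = 1.
    rewrite -{1}(powRr1 (ltW c0)) -!powRD ?(gt_eqF c0) ?implybT//.
    by rewrite (_ : 1 - a + (a - 1) = 0) ?powRr0//; ring.
  transitivity ((c * c `^ (- a) * c `^ (a - 1)) * (t `^ (a - 1) * expR (- (c * t))))%:E.
    by rewrite E mul1r.
  by rewrite -EFinM powRM ?ltW//; congr EFin; ring.
- apply/measurable_EFinP/measurable_funM.
    apply: measurable_funTS.
    by apply: (measurableT_comp (measurable_powR _)); exact: measurable_funM.
  apply: measurable_funTS; apply: (measurableT_comp measurable_expRN).
  exact: measurable_funM.
- by move=> x _; rewrite lee_fin mulr_ge0 ?powR_ge0 ?expR_ge0.
- by rewrite lee_fin mulr_ge0 ?powR_ge0 ?ltW.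
Qed.

End Gamma_function.

(** * Laguerre coefficients and an algebraic form of Rodrigues' formula *)

Section Laguerre_coefficients.
Variable R : realFieldType.
Implicit Types (nu a : R).

Definition lagc nu k r : R :=
  (-1) ^+ (k + r) * 'C(k, r)%:R * (poch (1 + nu) k / poch (1 + nu) r).

(** One step of Rodrigues' formula: if [p] is the polynomial for [nu + 1] and [k], the one for [nu]
    and [k + 1] is [t p - (nu + 1) p - t p']; this is its coefficient of [t^(r+1)]. *)
Lemma lagc_rec nu k r : - 1 < nu ->
  lagc nu k.+1 r.+1 = - (nu + 1 + r.+1%:R) * lagc (nu + 1) k r.+1 + lagc (nu + 1) k r.
Proof.
move=> nu1.
have p0 (a : R) n : -1 < a -> poch (1 + a) n != 0 by move=> a1; rewrite gt_eqF// poch_gt0//; lra.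
have nu0 : 1 + nu != 0 by rewrite gt_eqF//; lra.
have pS n : poch (1 + nu) n.+1 = (1 + nu) * poch (1 + (nu + 1)) n.
  by rewrite pochSl addrA.
have p1 := p0 (nu + 1) ^~ ltac:(lra).
rewrite /lagc binS natrD !pS.
have := pochSr (1 + (nu + 1)) r => pr; have := p1 r.+1; rewrite pr mulf_eq0 negb_or => /andP[pr0 nr0].
have := p1 r => q0.
rewrite !addnS addSn !exprS.
have e1 : r.+1%:R = r%:R + 1 :> R by rewrite natr1.
rewrite e1; field; repeat (apply/andP; split) => //.
Qed.

Lemma lagc_rec0 nu k : - 1 < nu -> lagc nu k.+1 0 = - (nu + 1) * lagc (nu + 1) k 0.
Proof.
move=> nu1; rewrite /lagc !bin0 !poch0 !addn0 exprS pochSl (_ : 1 + nu + 1 = 1 + (nu + 1)); ring.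
Qed.

(* The coefficients are those of (-1)^k k! L_k^nu, and the two recurrences replace
   k integrations by parts in Rodrigues' formula. *)
Lemma sum_lagc (M : R -> R -> R) nu k a :
    (forall a b, 0 < a -> 0 < b -> b * M a b = M a (b + 1) + M (a + 1) (b + 1)) ->
    (forall a b, 0 < a -> 0 < b -> a * M a b = M (a + 1) b + M (a + 1) (b + 1)) ->
    - 1 < nu -> 0 < a ->
  \sum_(r < k.+1) lagc nu k r * M a (nu + a + (k + r)%:R) =
  M (a + k%:R) (nu + a + k%:R).
Proof.
move=> Mr Ml; elim: k nu a => [|k IH] nu a nu1 a0.
  by rewrite big_ord1 /lagc !poch0 bin0 expr0 divr1 !mul1r addn0 !mulr0n !addr0.
rewrite big_ord_recl lagc_rec0//.
under eq_bigr do rewrite lift0 lagc_rec// mulrDl.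
rewrite big_split /= addrA.
have lagc0 : lagc (nu + 1) k k.+1 = 0 by rewrite /lagc bin_small// mulr0 mul0r.
rewrite [X in _ + X + _]big_ord_recr /= lagc0 mulr0 mul0r addr0.
have -> : - (nu + 1) * lagc (nu + 1) k 0 * M a (nu + a + (k.+1 + 0)%:R) +
  \sum_(i < k) - (nu + 1 + i.+1%:R) * lagc (nu + 1) k i.+1 * M a (nu + a + (k.+1 + i.+1)%:R) =
  \sum_(i < k.+1) - (nu + 1 + i%:R) * lagc (nu + 1) k i * M a (nu + a + (k.+1 + i)%:R).
  by rewrite [RHS]big_ord_recl /= addr0.
have nak : 0 < nu + 1 by lra.
rewrite -big_split /=.
have ak : 0 < a + k%:R by rewrite ltr_wpDr.
have := IH (nu + 1) a ltac:(lra) a0; have := IH (nu + 1) (a + 1) ltac:(lra) ltac:(lra).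
rewrite -natr1 => E1 E2.
have := Ml _ (nu + 1 + a + k%:R) ak ltac:(lra).
rewrite (_ : a + (k%:R + 1) = a + k%:R + 1); last by ring.
rewrite (_ : nu + a + (k%:R + 1) = nu + 1 + a + k%:R); last by ring.
move=> /eqP; rewrite -subr_eq => /eqP <-.
rewrite (_ : a + k%:R + 1 = a + 1 + k%:R); last by ring.
rewrite (_ : nu + 1 + a + k%:R + 1 = nu + 1 + (a + 1) + k%:R); last by ring.
rewrite -E1 -E2 mulr_sumr -sumrB; apply: eq_bigr => i _.
have s0 : 0 < nu + 1 + a + (k + i)%:R by rewrite ltr_wpDr//; lra.
have := Mr _ _ a0 s0.
rewrite addSn addnS -!natr1 natrD.
rewrite (_ : nu + a + (k%:R + i%:R + 1) = nu + 1 + a + (k%:R + i%:R)); last by ring.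
rewrite (_ : nu + a + (k%:R + i%:R + 1 + 1) = nu + 1 + a + (k%:R + i%:R) + 1); last by ring.
rewrite (_ : nu + 1 + (a + 1) + (k%:R + i%:R) = nu + 1 + a + (k%:R + i%:R) + 1); last by ring.
move=> /eqP; rewrite addrC -subr_eq => /eqP <-.
ring.
Qed.

End Laguerre_coefficients.

(** * A symmetric double Gamma integral and the closed form of [dcoef] *)

Section Double_gamma.
Variable R : realType.
Notation mu := (@lebesgue_measure R).
Local Notation RR := (measurableTypeR R * measurableTypeR R)%type.
Local Notation D0 := (`]0, +oo[%classic : set R).

(** The integrand of [Gamma a * Psi(a, 1 + a - b; 1)]. *)
Let psi_fun (a b t : R) : R := t `^ (a - 1) * expR (- t) * (1 + t) `^ (- b).

Let psi_int (a b : R) : R := \int[mu]_(t in D0) psi_fun a b t.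

Let measurable_psi_fun a b : measurable_fun [set: R] (psi_fun a b).
Proof.
apply: measurable_funM; first exact: measurable_Gamma_integrand.
by apply: (measurableT_comp (measurable_powR _)); exact: measurable_funD.
Qed.

Let psi_fun_ge0 a b t : 0 <= psi_fun a b t.
Proof. by rewrite !mulr_ge0 ?powR_ge0 ?expR_ge0. Qed.

Let psi_int_fin a b : 0 < a -> 0 < b ->
  (\int[mu]_(t in D0) (psi_fun a b t)%:E = (psi_int a b)%:E)%E.
Proof.
move=> a0 b0; rewrite /psi_int /Rintegral fineK// ge0_fin_numE; last first.
  by apply: integral_ge0 => t _; rewrite lee_fin.
apply: (@le_lt_trans _ _ (Gamma a)%:E); last exact: ltry.
rewrite -eGammaE//; apply: ge0_le_integral => //.
- by move=> t _; rewrite lee_fin.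
- by apply/measurable_EFinP; apply: measurable_funTS; exact: measurable_psi_fun.
- by apply/measurable_EFinP; apply: measurable_funTS; exact: measurable_Gamma_integrand.
- move=> t /in_half_line t0; rewrite lee_fin ler_piMr ?mulr_ge0 ?powR_ge0 ?expR_ge0//.
  rewrite -[leRHS](powRr0 (1 + t)); apply: ler_powR; first by rewrite lerDl ltW.
  by rewrite oppr_le0 ltW.
Qed.

(* [\int\int t^(a-1) y^(b-1) e^(-t-y-ty) dt dy], which is symmetric in a and b. *)
Definition dgamma (a b : R) : R :=
  Gamma b * \int[mu]_(t in D0) (t `^ (a - 1) * expR (- t) * (1 + t) `^ (- b)).

Let dgammaE a b : 0 < a -> 0 < b ->
  (\int[mu]_(t in D0) \int[mu]_(y in D0)
     (t `^ (a - 1) * y `^ (b - 1) * expR (- t - y - t * y))%:E = (dgamma a b)%:E)%E.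
Proof.
move=> a0 b0; rewrite /dgamma -/(psi_int a b) EFinM -psi_int_fin// -ge0_integralZl//=.
- apply: eq_integral => t /set_mem/in_half_line t0.
  transitivity ((t `^ (a - 1) * expR (- t))%:E * (Gamma b * (1 + t) `^ (- b))%:E)%E; last first.
    by rewrite -!EFinM; congr EFin; rewrite /psi_fun; ring.
  rewrite -eGamma_scale ?addr_gt0// -ge0_integralZl//=.
  + apply: eq_integral => y _; rewrite -EFinM; congr EFin.
    rewrite (_ : - t - y - t * y = - t + - ((1 + t) * y)); last by ring.
    by rewrite expRD; ring.
  + apply/measurable_EFinP/measurable_funM.
      by apply: measurable_funTS; exact: measurable_powR.
    apply: measurable_funTS; apply: (measurableT_comp (@measurable_expRN R)).
    exact: measurable_funM.
  + by move=> y _; rewrite lee_fin mulr_ge0 ?powR_ge0 ?expR_ge0.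
  + by rewrite lee_fin mulr_ge0 ?powR_ge0 ?expR_ge0.
- by apply/measurable_EFinP; apply: measurable_funTS; exact: measurable_psi_fun.
- by move=> t _; rewrite lee_fin.
- by rewrite lee_fin ltW// Gamma_gt0.
Qed.

Lemma dgammaC a b : 0 < a -> 0 < b -> dgamma a b = dgamma b a.
Proof.
move=> a0 b0; apply: EFin_inj; rewrite -(dgammaE a0 b0) -(dgammaE b0 a0).
pose f (z : RR) : R := z.1 `^ (a - 1) * z.2 `^ (b - 1) * expR (- z.1 - z.2 - z.1 * z.2).
have m1 : measurable_fun [set: RR] (fun z : RR => z.1 : R) by exact: measurable_fst.
have m2 : measurable_fun [set: RR] (fun z : RR => z.2 : R) by exact: measurable_snd.
have mf : measurable_fun [set: RR] f.
  apply: measurable_funM; first apply: measurable_funM.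
  - exact: (measurableT_comp (measurable_powR _) m1).
  - exact: (measurableT_comp (measurable_powR _) m2).
  - apply: measurableT_comp => //; apply: measurable_funB; last exact: measurable_funM.
    by apply: measurable_funB => //; exact: measurableT_comp.
rewrite (half_line_tonelli (f := f) mf); last first.
  by move=> x y _ _; rewrite !mulr_ge0 ?powR_ge0 ?expR_ge0.
apply: eq_integral => y _; apply: eq_integral => x _; congr EFin.
rewrite /f /= (_ : - x - y - x * y = - y - x - y * x); last by ring.
by rewrite [_ * y `^ _]mulrC.
Qed.

(** Under the integral this is [(1+t)^(-b) = (1+t) (1+t)^(-b-1)], combined with
    [Gamma (b+1) = b Gamma b]. *)
Lemma dgamma_recr a b : 0 < a -> 0 < b ->
  b * dgamma a b = dgamma a (b + 1) + dgamma (a + 1) (b + 1).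
Proof.
move=> a0 b0; have a1 := addr_gt0 a0 ltr01; have b1 := addr_gt0 b0 ltr01.
have dE c d : dgamma c d = Gamma d * psi_int c d by [].
rewrite !dE (Gamma_rec b0) -mulrDr -mulrA.
have -> // : psi_int a b = psi_int a (b + 1) + psi_int (a + 1) (b + 1).
apply: EFin_inj; rewrite EFinD -(psi_int_fin a0 b0) -(psi_int_fin a0 b1) -(psi_int_fin a1 b1).
rewrite -ge0_integralD//=.
- apply: eq_integral => t /set_mem/in_half_line t0; rewrite -EFinD; congr EFin.
  rewrite /psi_fun.
  have t10 : 0 < 1 + t by rewrite addr_gt0.
  have -> : (1 + t) `^ (- b) = (1 + t) * (1 + t) `^ (- (b + 1)).
    rewrite -{2}(powRr1 (ltW t10)) -powRD ?(gt_eqF t10) ?implybT//.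
    by congr (_ `^ _); ring.
  have -> : t `^ (a + 1 - 1) = t * t `^ (a - 1).
    rewrite -{2}(powRr1 (ltW t0)) -powRD ?(gt_eqF t0) ?implybT//.
    by congr (_ `^ _); ring.
  by ring.
- by move=> t _; rewrite lee_fin.
- by apply/measurable_EFinP; apply: measurable_funTS; exact: measurable_psi_fun.
- by move=> t _; rewrite lee_fin.
- by apply/measurable_EFinP; apply: measurable_funTS; exact: measurable_psi_fun.
Qed.

Lemma dgamma_recl a b : 0 < a -> 0 < b ->
  a * dgamma a b = dgamma (a + 1) b + dgamma (a + 1) (b + 1).
Proof.
move=> a0 b0; rewrite (dgammaC a0 b0) (dgamma_recr b0 a0).
have a1 := addr_gt0 a0 ltr01; have b1 := addr_gt0 b0 ltr01.
by rewrite (dgammaC b0 a1) (dgammaC b1 a1).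
Qed.

(** Each product of [Gamma] and [tricomi] in [dcoef] is [dgamma (1+m) (1+nu+k+r+m) / Gamma (1+m)]
    and the other factors form [lagc nu k r], so [sum_lagc] at [a = 1 + m] collapses the sum. *)
Lemma dcoefE nu k m : -1 < nu ->
  dcoef nu k m = Gamma (1 + nu) / Gamma (1 + m%:R) *
     dgamma ((m + k)%:R + 1) (1 + nu + (m + k)%:R).
Proof.
move=> nu1; have m0 : (0 : R) < 1 + m%:R by rewrite ltr_wpDr.
rewrite /dcoef -mulrA; congr (_ * _).
have -> : dgamma ((m + k)%:R + 1) (1 + nu + (m + k)%:R) =
  dgamma (1 + m%:R + k%:R) (nu + (1 + m%:R) + k%:R).
  have e1 : (m + k)%:R + 1 = 1 + m%:R + k%:R :> R by rewrite natrD; ring.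
  have e2 : 1 + nu + (m + k)%:R = nu + (1 + m%:R) + k%:R by rewrite natrD; ring.
  by rewrite e1 e2.
rewrite -(sum_lagc k dgamma_recr dgamma_recl nu1 m0) mulr_sumr; apply: eq_bigr => r _.
have -> : 1 + nu + (k + r + m)%:R = nu + (1 + m%:R) + (k + r)%:R.
  by rewrite natrD; ring.
rewrite /tricomi /lagc /dgamma.
set I1 := Rintegral _ _ _; set I2 := Rintegral _ _ _.
have -> : I1 = I2; last by ring.
rewrite /I1 /I2; apply: eq_Rintegral => t _; rewrite mul1r [expR _ * _]mulrC.
by congr (_ * _ * _ `^ _); rewrite natrD; ring.
Qed.

End Double_gamma.

(** * Positivity, measurability and moments of the weight *)

Section Weight.
Variables (R : realType) (nu : R).
Hypothesis nu1 : -1 < nu.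
Notation mu := (@lebesgue_measure R).
Local Notation RR := (measurableTypeR R * measurableTypeR R)%type.
Local Notation D0 := (`]0, +oo[%classic : set R).

Let ker (x t : R) := t `^ (nu - 1) * expR (- t - x * t `^ (- 1)).

Let kerE (x t : R) : 0 < t -> ker x t = t `^ (nu - 1) * expR (- t - x / t).
Proof. by move=> t0; rewrite /ker powR_inv1// ltW. Qed.

Let ker_ge0 x t : 0 <= ker x t.
Proof. by rewrite mulr_ge0 ?powR_ge0 ?expR_ge0. Qed.

Let measurable_ker x : measurable_fun [set: R] (ker x).
Proof.
apply: measurable_funM; first exact: measurable_powR.
apply: measurableT_comp => //; apply: measurable_funB => //.
by apply: measurable_funM => //; exact: measurable_powR.
Qed.

Let powR_nu (t : R) : 0 < t -> t * t `^ (nu - 1) = t `^ nu.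
Proof.
move=> t0; rewrite -{1}(powRr1 (ltW t0)) -powRD ?(gt_eqF t0) ?implybT//.
by rewrite addrC subrK.
Qed.

(** The point is finiteness: for [nu <= 0] the factor [t^(nu-1)] is not integrable at 0, but
    [e^(-x/t) <= t/x] raises the exponent to [nu], which leaves [Gamma (nu+1) / x]. *)
Let rhoE (x : R) : 0 < x -> ((rho nu x)%:E = \int[mu]_(t in D0) (ker x t)%:E)%E.
Proof.
move=> x0; rewrite /rho; under eq_Rintegral => t /set_mem/in_half_line t0 do rewrite -kerE//.
rewrite /Rintegral fineK// ge0_fin_numE; last first.
  by apply: integral_ge0 => t _; rewrite lee_fin.
apply: (@le_lt_trans _ _ (x^-1%:E * \int[mu]_(t in D0) (t `^ (nu + 1 - 1) * expR (- t))%:E)%E).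
  rewrite -ge0_integralZl//=.
  - apply: ge0_le_integral => //.
    + by move=> t _; rewrite lee_fin.
    + by apply/measurable_EFinP; apply: measurable_funTS; exact: measurable_ker.
    + apply/measurable_EFinP; apply: measurable_funM => //.
      by apply: measurable_funTS; exact: measurable_Gamma_integrand.
    + move=> t /in_half_line t0; rewrite lee_fin kerE// addrK -powR_nu//.
      rewrite expRD mulrA mulrAC [leRHS]mulrA ler_wpM2r ?expR_ge0//.
      rewrite mulrA mulrC ler_wpM2r ?powR_ge0// expRN.
      have xt0 : 0 < x / t by rewrite divr_gt0.
      rewrite -[x^-1 * t]invrK lef_pV2 ?posrE ?expR_gt0 ?invr_gt0 ?mulr_gt0 ?invr_gt0//.
      rewrite invfM invrK (le_trans _ (expR_ge1Dx _))//.
      by rewrite lerDr.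
  - by apply/measurable_EFinP; apply: measurable_funTS; exact: measurable_Gamma_integrand.
  - by move=> t _; rewrite lee_fin mulr_ge0 ?powR_ge0 ?expR_ge0.
  - by rewrite lee_fin invr_ge0 ltW.
have n1 : 0 < nu + 1 by rewrite -ltrBlDr sub0r.
by rewrite (eGammaE n1) -EFinM ltry.
Qed.

(** Only [1 <= t <= 2] is kept, where [t^(nu-1) >= t^(-2) >= 1/4] and [- t - x/t >= - 2 - x]. *)
Lemma rho_ge (x : R) : 0 < x -> 4^-1 * expR (- 2 - x) <= rho nu x.
Proof.
move=> x0; have nu1' := nu1; rewrite -lee_fin rhoE//; apply: (@half_line_integral_ge _ 1) => //.
- by apply: measurable_funTS; exact: measurable_ker.
- move=> t /andP[t1 t2]; have t0 : 0 < t by exact: lt_le_trans t1.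
  rewrite kerE//; apply: ler_pM; [by []|exact: expR_ge0| |].
  + apply: (@le_trans _ _ (t `^ (- 2%:R))); last by apply: ler_powR => //; lra.
    rewrite powR_invn ?(ltW t0)// lef_pV2 ?posrE ?exprn_gt0//.
    by rewrite expr2; nra.
  + rewrite ler_expR; have : x / t <= x by rewrite ler_pdivrMr// ler_peMr// ltW.
    by move=> xt; lra.
Qed.

Let mker2 : measurable_fun [set: RR] (fun z : RR => ker z.1 z.2).
Proof.
have m1 : measurable_fun [set: RR] (fun z : RR => z.1 : R) by exact: measurable_fst.
have m2 : measurable_fun [set: RR] (fun z : RR => z.2 : R) by exact: measurable_snd.
apply: measurable_funM; first exact: (measurableT_comp (measurable_powR _) m2).
apply: measurableT_comp => //; apply: measurable_funB; first exact: measurableT_comp.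
by apply: measurable_funM => //; exact: (measurableT_comp (measurable_powR _) m2).
Qed.

Lemma measurable_rho : measurable_fun D0 (rho nu).
Proof.
apply/measurable_EFinP.
apply: (@eq_measurable_fun _ _ _ _ _ (fun x => \int[mu]_(t in D0) (ker x t)%:E)%E).
  by move=> x /set_mem/in_half_line x0; rewrite /= rhoE.
exact: (measurable_half_line_integral mker2 (fun x y _ _ => ker_ge0 x y)).
Qed.

Definition weight x := expR (- x) * rho nu x.

Lemma weight_gt0 (x : R) : 0 < x -> 0 < weight x.
Proof.
move=> x0; rewrite mulr_gt0 ?expR_gt0// (lt_le_trans _ (rho_ge x0))//.
by rewrite mulr_gt0 ?expR_gt0.
Qed.

Lemma measurable_weight : measurable_fun D0 weight.
Proof.
by apply: measurable_funM; [exact: measurable_funTS (@measurable_expRN R)|exact: measurable_rho].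
Qed.

Definition moment (p : nat) : R := dgamma (p%:R + 1) (1 + nu + p%:R).

(** With the order exchanged, the integral in [x] is a Gamma integral with rate [1 + 1/y]. Since
    [(1+1/y)^(-p-1) = y^(p+1) (1+y)^(-p-1)], what remains is [moment p] with the two parameters of
    [dgamma] swapped. *)
Lemma integral_moment p : (\int[mu]_(x in D0) (x ^+ p * weight x)%:E = (moment p)%:E)%E.
Proof.
have p1 : (0 : R) < p%:R + 1 by rewrite ltr_wpDl.
have np : 0 < 1 + nu + p%:R by have nu1' := nu1; rewrite ltr_wpDr//; lra.
pose f (z : RR) := z.1 `^ (p%:R + 1 - 1) * expR (- z.1) * ker z.1 z.2.
have m1 : measurable_fun [set: RR] (fun z : RR => z.1 : R) by exact: measurable_fst.
have mf : measurable_fun [set: RR] f.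
  by apply: measurable_funM => //; exact: (measurableT_comp (measurable_Gamma_integrand _) m1).
have f0 x y : 0 < x -> 0 < y -> 0 <= f (x, y).
  by move=> _ _; rewrite !mulr_ge0 ?powR_ge0 ?expR_ge0.
transitivity (\int[mu]_(x in D0) \int[mu]_(y in D0) (f (x, y))%:E)%E.
  apply: eq_integral => x /set_mem/in_half_line x0.
  rewrite /weight mulrA EFinM rhoE// -ge0_integralZl//=.
  - apply: eq_integral => t _.
    by rewrite -EFinM /f /= addrK powR_mulrn// ltW.
  - by apply/measurable_EFinP; apply: measurable_funTS; exact: measurable_ker.
  - by move=> t _; rewrite lee_fin.
  - by rewrite lee_fin mulr_ge0 ?expR_ge0// exprn_ge0// ltW.
rewrite (half_line_tonelli mf f0).
rewrite /moment dgammaC// /dgamma EFinM.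
pose h (t : R) := t `^ (1 + nu + p%:R - 1) * expR (- t) * (1 + t) `^ (- (p%:R + 1)).
have mh : measurable_fun [set: R] h.
  apply: measurable_funM; first exact: measurable_Gamma_integrand.
  by apply: (measurableT_comp (measurable_powR _)); exact: measurable_funD.
have h0 t : 0 <= h t by rewrite !mulr_ge0 ?powR_ge0 ?expR_ge0.
have hle : (\int[mu]_(t in D0) (h t)%:E <= (Gamma (1 + nu + p%:R))%:E)%E.
  rewrite -eGammaE//; apply: ge0_le_integral => //.
  - by move=> t _; rewrite lee_fin.
  - by apply/measurable_EFinP; exact: measurable_funTS.
  - by apply/measurable_EFinP; apply: measurable_funTS; exact: measurable_Gamma_integrand.
  - move=> t /in_half_line t0; rewrite lee_fin ler_piMr ?mulr_ge0 ?powR_ge0 ?expR_ge0//.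
    rewrite -[leRHS](powRr0 (1 + t)); apply: ler_powR; first by rewrite lerDl ltW.
    by rewrite oppr_le0 ltW.
have hfin : (\int[mu]_(t in D0) (h t)%:E)%E \is a fin_num.
  rewrite ge0_fin_numE; first exact: le_lt_trans hle (ltry _).
  by apply: integral_ge0 => t _; rewrite lee_fin.
have hE : ((\int[mu]_(t in D0) h t)%R%:E = \int[mu]_(t in D0) (h t)%:E)%E.
  by rewrite /Rintegral fineK.
transitivity ((Gamma (p%:R + 1))%:E * \int[mu]_(t in D0) (h t)%:E)%E; last by rewrite -hE.
rewrite -ge0_integralZl//=.
- apply: eq_integral => y /set_mem/in_half_line y0.
  have c0 : 0 < 1 + y^-1 by rewrite addr_gt0 ?invr_gt0.
  transitivity ((y `^ (nu - 1) * expR (- y))%:E *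
     \int[mu]_(x in D0) (x `^ (p%:R + 1 - 1) * expR (- ((1 + y^-1) * x)))%:E)%E.
    rewrite -ge0_integralZl//=.
    + apply: eq_integral => x _; rewrite /f /= kerE// -EFinM; congr EFin.
      transitivity (x `^ (p%:R + 1 - 1) * y `^ (nu - 1) * (expR (- x) * expR (- y - x / y))).
        by ring.
      transitivity (x `^ (p%:R + 1 - 1) * y `^ (nu - 1) * (expR (- y) * expR (- ((1 + y^-1) * x)))).
        by rewrite -!expRD; congr (_ * expR _); field; rewrite gt_eqF.
      by ring.
    + apply/measurable_EFinP/measurable_funM.
        by apply: measurable_funTS; exact: measurable_powR.
      apply: measurable_funTS; apply: (measurableT_comp (@measurable_expRN R)).
      exact: measurable_funM.
    + by move=> x _; rewrite lee_fin mulr_ge0 ?powR_ge0 ?expR_ge0.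
    + by rewrite lee_fin mulr_ge0 ?powR_ge0 ?expR_ge0.
  rewrite eGamma_scale// -!EFinM; congr EFin.
  have yE q : y `^ (- q) = (y^-1) `^ q by rewrite -powR_inv1 ?ltW// -powRrM mulN1r.
  have -> : (1 + y^-1) `^ (- (p%:R + 1)) = (1 + y) `^ (- (p%:R + 1)) * y `^ (p%:R + 1).
    have -> : 1 + y^-1 = (1 + y) * y^-1 by field; rewrite gt_eqF.
    rewrite powRM ?invr_ge0 ?addr_ge0 ?ltW//; congr (_ * _).
    by rewrite -yE opprK.
  rewrite /h.
  have -> : y `^ (1 + nu + p%:R - 1) = y `^ (nu - 1) * y `^ (p%:R + 1).
    by rewrite -powRD ?(gt_eqF y0) ?implybT//; congr (_ `^ _); ring.
  by ring.
- by apply/measurable_EFinP; exact: measurable_funTS.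
- by move=> t _; rewrite lee_fin.
- by rewrite lee_fin ltW// Gamma_gt0.
Qed.

Let integrable_monomial p :
  mu.-integrable D0 (fun x => (x ^+ p * weight x)%:E).
Proof.
apply/integrableP; split.
  apply/measurable_EFinP; apply: measurable_funM; last exact: measurable_weight.
  by apply: measurable_funTS; exact: exprn_measurable.
rewrite (_ : (\int[mu]_(x in D0) _)%E = (moment p)%:E) ?ltry// -integral_moment.
apply: eq_integral => x /set_mem/in_half_line x0.
by rewrite gee0_abs// lee_fin mulr_ge0 ?exprn_ge0 ?ltW ?weight_gt0.
Qed.

Lemma integrable_poly (p : {poly R}) :
  mu.-integrable D0 (fun x => (p.[x] * weight x)%:E).
Proof.
rewrite (_ : (fun x => _) =
  (fun x => \sum_(i < size p) ((p`_i)%:E * (x ^+ i * weight x)%:E))%E); last first.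
  apply/funext => x; rewrite horner_coef mulr_suml -sumEFin.
  by apply: eq_bigr => i _; rewrite -EFinM -mulrA.
apply: integrable_sum => //= i _; apply: integrableZl => //.
Qed.

(** The integral against the weight as a finite sum, so that orthogonality becomes linear algebra on
    coefficients. *)
Definition mom (p : {poly R}) : R := \sum_(i < size p) p`_i * moment i.

Lemma integral_poly (p : {poly R}) :
  (\int[mu]_(x in D0) (p.[x] * weight x)%:E = (mom p)%:E)%E.
Proof.
transitivity (\int[mu]_(x in D0) \sum_(i < size p) ((p`_i)%:E * (x ^+ i * weight x)%:E))%E.
  apply: eq_integral => x _; rewrite horner_coef mulr_suml -sumEFin.
  by apply: eq_bigr => i _; rewrite -EFinM -mulrA.
rewrite integral_sum//; last first.
  by move=> i; apply: integrableZl => //; exact: integrable_monomial.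
rewrite /mom -sumEFin; apply: eq_bigr => i _.
rewrite integralZl//.
by rewrite integral_moment -EFinM.
Qed.

End Weight.

(** * Bounding a polynomial at a point by its weighted square integral *)

Section Pointwise_bound.
Variable R : realType.
Notation mu := (@lebesgue_measure R).
Local Notation D0 := (`]0, +oo[%classic : set R).
Implicit Types (p q : {poly R}).

(* The coefficient at 0 is p`_0 / 0 = 0. *)
Definition primitive p : {poly R} := \poly_(i < (size p).+1) (p`_i.-1 / i%:R).

Lemma deriv_primitive p : (primitive p)^`() = p.
Proof.
apply/polyP => i; rewrite coef_deriv coef_poly ltnS.
case: ltnP => pi; last by rewrite mul0rn nth_default.
by rewrite /= -[LHS]mulr_natr divfK// pnatr_eq0.
Qed.

(** The quotient [s = (p - p(0)) / X] has degree at most [n], so its difference of order [n + 1] at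
    0 vanishes, which expresses [s(0)] through [s(1), ..., s(n+1)]. *)
Lemma coef1_fin_diff p n : (size p <= n.+2)%N ->
  p`_1 = - \sum_(i < n.+1)
    (-1) ^+ i.+1 * 'C(n.+1, i.+1)%:R * ((p.[i.+1%:R] - p.[0]) / i.+1%:R).
Proof.
move=> pn; pose s := drop_poly 1 p.
have sE y : s.[y] * y = p.[y] - p.[0].
  rewrite -[p in RHS](poly_take_drop 1) !hornerD !hornerM !hornerXn !expr1 mulr0 addr0.
  have : (size (take_poly 1 p) <= 1)%N by exact: size_take_poly.
  by move=> /size1_polyC ->; rewrite !hornerC addrAC subrr add0r.
have : (iter n.+1 (@bdiff R) s).[0] = 0.
  rewrite iter_bdiff_eq0 ?horner0// size_drop_poly.
  by rewrite leq_subLR add1n.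
rewrite iter_bdiff_eval big_ord_recl /= expr0 bin0 !mul1r addr0 horner_coef0 coef_drop_poly add0n.
move=> /eqP; rewrite addr_eq0 => /eqP ->; congr (- _); apply: eq_bigr => i _.
rewrite /bump /= add1n add0r -sE mulfK// pnatr_eq0.
Qed.

(** Increments of the primitive from [x] within [[x, x+1]] are at most [1 + I / c], because
    [|p| <= 1 + p^2] and [W >= c] there. Recovering its derivative at [x] from [n + 1] increments
    costs [2^(n+1)], a bound for the binomial sum, and [n + 1], the inverse step. *)
Lemma poly_pointwise p n x c (W : R -> R) I : 0 < x -> 0 < c ->
  (size p <= n.+1)%N -> measurable_fun D0 W -> (forall t, 0 < t -> 0 <= W t) ->
  (forall t, x <= t <= x + 1 -> c <= W t) ->
  (\int[mu]_(t in D0) (p.[t] ^+ 2 * W t)%:E = I%:E)%E ->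
  `|p.[x]| <= 2 ^+ n.+1 * n.+1%:R * (1 + I / c).
Proof.
move=> x0 c0 pn mW W0 Wc WI; pose Q := primitive p.
have mp2W : measurable_fun D0 (fun t => p.[t] ^+ 2 * W t).
  apply: measurable_funM => //; apply: measurable_funTS.
  apply: measurable_funX; apply: continuous_measurable_fun; exact: continuous_horner.
have sD y : `[x, y]%classic `<=` D0.
  by move=> t /=; rewrite !in_itv/= andbT => /andP[xt _]; exact: lt_le_trans xt.
have bnd y : x < y <= x + 1 -> `|Q.[y] - Q.[x]| <= 1 + I / c.
  move=> /andP[xy yx]; rewrite -lee_fin.
  have dQ : forall t, derivable (fun t : R => Q.[t]) t 1 by move=> t; exact: derivable_horner.
  have := @continuous_FTC2 R (horner p) (horner Q) x y xy.
  have -> // : ((Q.[y])%:E - (Q.[x])%:E = (Q.[y] - Q.[x])%:E)%E by rewrite EFinB.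
  move=> FTC.
  have {}FTC : (\int[mu]_(t in `[x, y]) (p.[t])%:E)%E = (Q.[y] - Q.[x])%:E.
    apply: FTC.
    - by apply: continuous_subspaceT; exact: continuous_horner.
    - split; first by move=> t _; exact: dQ.
      + by apply: cvg_at_right_filter; exact: continuous_horner.
      + by apply: cvg_at_left_filter; exact: continuous_horner.
    - by move=> t _; rewrite -derivE deriv_primitive.
  rewrite -[(`|_|)%:E]/(`|(Q.[y] - Q.[x])%:E|)%E -FTC.
  apply: (le_trans (le_abse_integral _ _ _)) => //.
    by apply/measurable_EFinP; apply: measurable_funTS; apply: continuous_measurable_fun; exact: continuous_horner.
  have mh : measurable_fun `[x, x + 1] (fun t => (1 + c^-1 * (p.[t] ^+ 2 * W t))%:E).
    apply/measurable_EFinP; apply: measurable_funD => //; apply: measurable_funM => //.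
    exact: measurable_funS mp2W.
  have sxy : `[x, y]%classic `<=` `[x, x + 1]%classic.
    by move=> t /=; rewrite !in_itv/= => /andP[-> /le_trans ->].
  have h0 t : `[x, x + 1]%classic t -> 0 <= p.[t] ^+ 2 * W t.
    by move=> /sD/in_half_line t0; rewrite mulr_ge0 ?sqr_ge0 ?W0.
  have ci : 0 <= c^-1 by rewrite invr_ge0 ltW.
  apply: (@le_trans _ _ (\int[mu]_(t in `[x, y]) (1 + c^-1 * (p.[t] ^+ 2 * W t))%:E)%E).
    apply: ge0_le_integral => //.
    - apply: measurableT_comp => //; apply/measurable_EFinP; apply: measurable_funTS.
      by apply: continuous_measurable_fun; exact: continuous_horner.
    - exact: measurable_funS mh.
    - move=> t txy; rewrite lee_fin.
      have /Wc Wt : x <= t <= x + 1 by move/sxy: txy; rewrite /= in_itv.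
      apply: (@le_trans _ _ (1 + p.[t] ^+ 2)).
        by rewrite -(real_normK (num_real _)); have := normr_ge0 p.[t]; nra.
      rewrite lerD2l mulrCA ler_peMr ?sqr_ge0// mulrC ler_pdivlMr// mul1r//.
  apply: (@le_trans _ _ (\int[mu]_(t in `[x, (x + 1)%R]) (1 + c^-1 * (p.[t] ^+ 2 * W t))%:E)%E).
    apply: ge0_subset_integral => // t txy.
    by rewrite lee_fin addr_ge0// mulr_ge0// h0.
  under eq_integral do rewrite EFinD EFinM.
  have mf : measurable_fun `[x, x + 1] (fun t => (p.[t] ^+ 2 * W t)%:E).
    by apply/measurable_EFinP; exact: measurable_funS mp2W.
  rewrite ge0_integralD//; last 2 first.
  - by move=> t txy; rewrite -EFinM lee_fin mulr_ge0// h0.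
  - exact: measurable_funeM.
  rewrite integral_cst//= lebesgue_measure_itv/= lte_fin ltrDl ltr01.
  rewrite -EFinB -EFinM mul1r addrAC subrr add0r EFinD leeD2l//.
  rewrite ge0_integralZl//.
  rewrite mulrC EFinM lee_wpmul2l ?lee_fin// -WI.
  apply: ge0_subset_integral => //; first exact/measurable_EFinP.
  by move=> t /in_half_line t0; rewrite lee_fin mulr_ge0 ?sqr_ge0 ?W0.
(* This step keeps the nodes [x + e i], [1 <= i <= n + 1], inside []x, x + 1]]; [T] rescales them to
   integers, and its coefficient of degree 1 is [e p(x)]. *)
pose e : R := n.+1%:R^-1.
have e0 : 0 < e by rewrite invr_gt0.
pose T := Q \Po (e%:P * 'X + x%:P).
have TE y : T.[y] = Q.[x + e * y] by rewrite /T horner_comp !hornerE addrC.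
have T1 : T`_1 = e * p.[x].
  have -> : T`_1 = (T^`()).[0] by rewrite horner_coef0 coef_deriv.
  rewrite /T deriv_comp deriv_primitive derivD derivC addr0 mul_polyC derivZ derivX.
  by rewrite hornerM horner_comp !hornerE /= mulr1 mulrC.
have sT : (size T <= n.+2)%N.
  have sQ : (size Q <= n.+2)%N by rewrite (leq_trans (size_poly _ _))// ltnS.
  apply: leq_trans sQ; rewrite /T size_comp_poly2//.
  by rewrite size_MXaddC polyC_eq0 (gt_eqF e0)/= size_polyC (gt_eqF e0).
have B0 : 0 <= 1 + I / c.
  apply: le_trans (bnd (x + 1) _); first exact: normr_ge0.
  by rewrite lexx ltrDl ltr01.
have : `|e * p.[x]| <= 2 ^+ n.+1 * (1 + I / c).
  rewrite -T1 (coef1_fin_diff sT) normrN.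
  apply: (le_trans (ler_norm_sum _ _ _)).
  apply: (@le_trans _ _ (\sum_(i < n.+1) 'C(n.+1, i.+1)%:R * (1 + I / c))).
    apply: ler_sum => i _; rewrite !normrM normrX normrN1 expr1n mul1r normfV !normr_nat.
    rewrite ler_wpM2l// !TE mulr0 addr0.
    rewrite ler_pdivrMr//.
    apply: le_trans (bnd _ _) _.
      rewrite ltrDl mulr_gt0//= lerD2l /e mulrC ler_pdivrMr// mul1r ler_nat.
      exact: ltn_ord.
    by rewrite ler_peMr// ler1n.
  rewrite -mulr_suml ler_wpM2r// -natr_sum -natrX ler_nat.
  have := expnDn 1 1 n.+1; rewrite addn1 => ->.
  rewrite [leqRHS]big_ord_recl; apply: leq_trans (leq_addl _ _).
  by apply: leq_sum => i _; rewrite !exp1n !muln1.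
rewrite normrM (gtr0_norm e0) /e mulrC ler_pdivrMr//.
by rewrite mulrAC.
Qed.

Variable nu : R.
Hypothesis nu1 : -1 < nu.

(** The weight and [rho_ge] contribute one [e^(-t)] each, and [- 2 - 2 t >= - 4 - 2 x] for
    [t <= x + 1]. *)
Lemma weight_ge x t : 0 < x -> x <= t <= x + 1 ->
  4^-1 * expR (- 4 - 2 * x) <= weight nu t.
Proof.
move=> x0 /andP[xt tx]; have t0 : 0 < t by exact: lt_le_trans xt.
apply: (@le_trans _ _ (expR (- t) * (4^-1 * expR (- 2 - t)))); last first.
  by rewrite ler_wpM2l ?expR_ge0// rho_ge.
by rewrite mulrCA -expRD ler_wpM2l// ler_expR; lra.
Qed.

Lemma weight_pointwise_bound x : 0 < x ->
  exists2 K : R, 0 <= K & forall p n, (size p <= n.+1)%N -> mom nu (p * p) = 1 ->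
    `|p.[x]| <= 2 ^+ n.+1 * n.+1%:R * K.
Proof.
move=> x0; pose c : R := 4^-1 * expR (- 4 - 2 * x).
have c0 : 0 < c by rewrite mulr_gt0 ?expR_gt0.
exists (1 + 1 / c); first by rewrite addr_ge0// divr_ge0// ltW.
move=> p n pn pp; apply: (poly_pointwise (W := weight nu)) => //.
- exact: measurable_weight.
- by move=> t t0; rewrite ltW// weight_gt0.
- by move=> t; exact: weight_ge.
- rewrite -pp -(integral_poly nu1); apply: eq_integral => t _.
  by rewrite hornerM expr2.
Qed.

(** For the weight [t * weight nu t] every multiple [l *: q] has square integral 0, so
    [poly_pointwise] bounds [l q(x)] by a constant independent of [l]. Hence [q] vanishes at every
    positive [x]. *)
Lemma mom_XM_eq0 q : mom nu ('X * (q * q)) = 0 -> q = 0.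
Proof.
move=> q0; have qx x : 0 < x -> q.[x] = 0.
  move=> x0; pose c : R := x * (4^-1 * expR (- 4 - 2 * x)).
  have c0 : 0 < c by rewrite !mulr_gt0 ?expR_gt0.
  pose K : R := 2 ^+ (size q).+1 * (size q).+1%:R.
  have K0 : 0 < K by rewrite mulr_gt0 ?exprn_gt0.
  have bnd (l : R) : `|l * q.[x]| <= K.
    rewrite -hornerZ.
    have := @poly_pointwise (l *: q) (size q) x c (fun t => t * weight nu t) 0 x0 c0.
    rewrite mul0r addr0 mulr1; apply.
    - exact: leq_trans (size_scale_leq _ _) _.
    - by apply: measurable_funM => //; exact: measurable_weight.
    - by move=> t t0; rewrite mulr_ge0 ?ltW// weight_gt0.
    - move=> t /andP[xt tx]; rewrite /c ler_pM ?(ltW x0)// ?mulr_ge0 ?expR_ge0//.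
      by apply: weight_ge; rewrite ?xt.
    - rewrite (_ : 0%:E = (l ^+ 2)%:E * (mom nu ('X * (q * q)))%:E)%E; last by rewrite q0 mule0.
      rewrite -(integral_poly nu1) -integralZl//; last exact: integrable_poly.
      apply: eq_integral => t _; rewrite -EFinM !hornerE /=; congr EFin; ring.
  apply/eqP; rewrite -normr_eq0 eq_le normr_ge0 andbT leNgt; apply/negP => q1.
  have qx0 : q.[x] != 0 by rewrite -normr_gt0.
  have := bnd ((K + 1) / q.[x]); rewrite (divfK qx0).
  by move=> /(le_trans (ler_norm _)); lra.
apply/eqP/negPn/negP => qn0.
pose s : seq R := [seq i.+1%:R | i <- iota 0 (size q)].
have us : uniq s.
  rewrite map_inj_uniq ?iota_uniq// => i j /eqP; rewrite eqr_nat eqSS => /eqP //.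
have rs : all (root q) s.
  by apply/allP => y /mapP[i _ ->]; apply/rootP/qx.
by have := max_poly_roots qn0 rs us; rewrite size_map size_iota ltnn.
Qed.

End Pointwise_bound.

(** * Cramer's rule in a division-free form *)

Section Cramer.
Variable F : fieldType.

Lemma cramer_col n (M : 'M[F]_n) (u b : 'cV[F]_n) a k : M *m u = a *: b ->
  \det M * u k 0 = a * \det (\matrix_(i, j) if j == k then b i 0 else M i j).
Proof.
move=> Mu.
have -> : \det M * u k 0 = (\adj M *m (M *m u)) k 0.
  by rewrite mulmxA mul_adj_mx mul_scalar_mx mxE.
rewrite Mu -scalemxAr mxE; congr (_ * _); rewrite mxE (expand_det_col _ k).
apply: eq_bigr => i _; rewrite !mxE eqxx mulrC; congr (_ * _).
rewrite /cofactor; congr (_ * \det _).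
by apply/matrixP => r s; rewrite !mxE eq_sym (negbTE (neq_lift _ _)).
Qed.

End Cramer.

(** * Orthogonality, and the coefficients of [P_n] as ratios of determinants *)

Section Coefficients.
Variables (R : realType) (nu : R) (P : nat -> {poly R}).
Hypotheses (nu1 : -1 < nu) (hP : orthonormal_polys nu P).
Implicit Types (p q : {poly R}).

Lemma momE p N : (size p <= N)%N -> mom nu p = \sum_(i < N) p`_i * moment nu i.
Proof.
move=> pN; rewrite /mom -(subnKC pN) big_split_ord /= [X in _ = _ + X]big1 ?addr0// => i _.
by rewrite nth_default ?mul0r// leq_addr.
Qed.

Lemma momD p q : mom nu (p + q) = mom nu p + mom nu q.
Proof.
pose N := maxn (size p) (size q).
rewrite (@momE p N) ?leq_maxl// (@momE q N) ?leq_maxr// (@momE (p + q) N) ?size_polyD//.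
by rewrite -big_split; apply: eq_bigr => i _; rewrite coefD mulrDl.
Qed.

Lemma momZ c p : mom nu (c *: p) = c * mom nu p.
Proof.
rewrite (@momE (c *: p) (size p)) ?size_scale_leq// /mom mulr_sumr.
by apply: eq_bigr => i _; rewrite coefZ mulrA.
Qed.

Lemma mom_sum I (r : seq I) (p : I -> {poly R}) :
  mom nu (\sum_(i <- r) p i) = \sum_(i <- r) mom nu (p i).
Proof.
apply: (big_morph (mom nu) momD); by rewrite /mom size_poly0 big_ord0.
Qed.

Lemma mom_orthonormal m n : mom nu (P m * P n) = (m == n)%:R.
Proof.
case: hP => _ _ /(_ m n) <-.
rewrite /Rintegral -[LHS]/(fine (mom nu (P m * P n))%:E) -(integral_poly nu1).
by congr fine; apply: eq_integral => t _; rewrite hornerM !mulrA.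
Qed.

Lemma mom_orthogonal q k n : (size q <= k)%N -> (k <= n)%N -> mom nu (q * P n) = 0.
Proof.
case: hP => sP lP _.
elim: k q => [|k IH] q qk kn.
  move: qk; rewrite leqn0 size_poly_eq0 => /eqP ->.
  by rewrite mul0r /mom size_poly0 big_ord0.
pose c := q`_k / lead_coef (P k).
have -> : q = (q - c *: P k) + c *: P k by rewrite subrK.
rewrite mulrDl momD -scalerAl momZ mom_orthonormal (ltn_eqF kn) mulr0 addr0.
apply: IH; last exact: ltnW.
apply/leq_sizeP => j; rewrite leq_eqVlt => /predU1P[<-|kj].
  have lk : lead_coef (P k) = (P k)`_k by rewrite /lead_coef sP.
  by rewrite coefB coefZ -lk divfK ?subrr// gt_eqF.
rewrite coefB coefZ [in X in _ - X]nth_default ?sP// mulr0 subr0.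
by rewrite nth_default// (leq_trans qk).
Qed.

Lemma mom_XnM m p N : (size p <= N)%N ->
  mom nu ('X^m * p) = \sum_(i < N) p`_i * moment nu (m + i).
Proof.
move=> pN.
have s : (size ('X^m * p)%R <= m + N)%N.
  by rewrite (leq_trans (size_polyMleq _ _))// size_polyXn addSn /= leq_add2l.
rewrite (momE s) big_split_ord /= big1 ?add0r => [|i _]; last first.
  by rewrite coefXnM ltn_ord mul0r.
by apply: eq_bigr => i _; rewrite coefXnM ltnNge leq_addr /= addKn.
Qed.

Lemma dcoef_moment k m :
  dcoef nu k m = Gamma (1 + nu) / Gamma (1 + m%:R) * moment nu (m + k).
Proof. exact: dcoefE. Qed.

Let c m : R := Gamma (1 + nu) / Gamma (1 + m%:R).

Let c_neq0 m : c m != 0.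
Proof.
rewrite mulf_neq0 ?invr_eq0// gt_eqF// Gamma_gt0//.
  by have h := nu1; lra.
Qed.

Lemma sum_coef_dcoef n m : (m < n)%N ->
  \sum_(r < n.+1) (P n)`_r * dcoef nu r m = 0.
Proof.
move=> mn; have s : (size (P n) <= n.+1)%N by case: hP => ->.
have := mom_XnM m s; rewrite (@mom_orthogonal _ m.+1 n) ?size_polyXn// => E.
transitivity (c m * \sum_(i < n.+1) (P n)`_i * moment nu (m + i)); last by rewrite -E mulr0.
rewrite mulr_sumr; apply: eq_bigr => r _.
by rewrite dcoef_moment mulrCA.
Qed.

(** A left kernel vector, with the row factors [c m] absorbed, is a polynomial [q] of degree below
    [n]. The columns being numbered from 1, it satisfies [mom (X^(j+1) q) = 0] for [j < n], hence
    [mom (X q q) = 0]. *)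
Lemma Ddet_neq0 n : Ddet nu n != 0.
Proof.
apply/negP => /det0P[v vn0 vA].
pose w : 'rV_n := \row_m (v 0 m * c m); pose q := rVpoly w.
have sq : (size q <= n)%N by exact: size_poly.
have q0 : mom nu ('X * (q * q)) = 0.
  rewrite {1}(_ : q = \sum_(j < n) q`_j *: 'X^j); last first.
    rewrite -poly_def; apply/polyP => i; rewrite [RHS]coef_poly.
    by case: ltnP => // ni; rewrite nth_default// (leq_trans sq).
  rewrite mulr_suml mulr_sumr mom_sum big1 // => j _.
  rewrite -scalerAl -scalerAr momZ mulrA -exprS (mom_XnM _ sq).
  have := congr1 (fun A : 'rV_n => A 0 j) vA; rewrite !mxE => E.
  suff -> : \sum_(i < n) q`_i * moment nu (j.+1 + i) = 0 by rewrite mulr0.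
  rewrite -[RHS]E; apply: eq_bigr => i _.
  rewrite coef_rVpoly_ord !mxE dcoef_moment (addnC i).
  by rewrite [RHS]mulrA.
have q00 := mom_XM_eq0 nu1 q0.
case/negP: vn0; apply/eqP/rowP => m; rewrite mxE.
have := coef_rVpoly_ord w m; rewrite -/q q00 coef0 mxE => /esym/eqP.
by rewrite mulf_eq0 (negbTE (c_neq0 m)) orbF => /eqP.
Qed.

(** Moving the constant coefficient to the right-hand side of the orthogonality relations leaves a
    square system for the coefficients of degree 1 to [n]. For [r = 0] the convention
    [D_(n,0) = - D_n] makes the formula a tautology. *)
Lemma coef_orthonormal n r : (r <= n)%N ->
  (P n)`_r = - ((P n)`_0 / Ddet nu n) * Ddet_col nu n r.
Proof.
have D0 := Ddet_neq0 n; rewrite /Ddet_col.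
case: r => [_|r rn] /=; first by field.
pose M := \matrix_(m < n, j < n) dcoef nu j.+1 m.
pose u : 'cV[R]_n := \col_j ((P n)`_j.+1).
pose b : 'cV[R]_n := \col_m dcoef nu 0 m.
have Mu : M *m u = - (P n)`_0 *: b.
  apply/colP => m; rewrite !mxE; have := sum_coef_dcoef (ltn_ord m).
  rewrite big_ord_recl /= => /eqP; rewrite addrC addr_eq0 mulNr => /eqP <-.
  by apply: eq_bigr => j _; rewrite !mxE mulrC.
have := cramer_col (Ordinal rn) Mu; rewrite !mxE.
set d1 := \det _; set d2 := \det _; set d3 := \det _.
have -> : d2 = d3.
  rewrite /d2 /d3; congr (\det _); apply/matrixP => i j; rewrite !mxE.
  by rewrite -val_eqE /= eqSS.
rewrite -[d1]/(Ddet nu n) => E.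
by apply: (mulfI D0); rewrite E; field.
Qed.

End Coefficients.

(** * The coefficients [f_(2n,k)] and the evaluation of both double sums *)

Section Expansion_coefficients.
Variables (R : realType) (nu : R).
Hypothesis nu1 : -1 < nu.

(** Here [(-k)_i / i! = (-1)^i 'C(k, i)], and [(a)_r (a+r)_i = (a)_i (a+i)_r] for [a = 1 + nu] and
    [a = 1] turns the remaining factors into the value of [tpoly nu r] at [i]. *)
Lemma hyp3F2_bdiff r k :
  r`!%:R * poch (1 + nu) r *
    hyp3F2 (- k%:R) (1 + nu + r%:R) (1 + r%:R) (1 + nu) 1 1 =
  (iter k (@bdiff R) (tpoly nu r)).[0].
Proof.
rewrite iter_bdiff_eval /hyp3F2.
pose f i : R := poch (- k%:R) i * poch (1 + nu + r%:R) i * poch (1 + r%:R) i /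
   (poch (1 + nu) i * poch 1 i) * 1 ^+ i / i`!%:R.
have pk i : poch (- k%:R) i = (-1) ^+ i * ('C(k, i) * i`!)%N%:R :> R.
  elim: i => [|i IH]; first by rewrite poch0 bin0 expr0 mulr1.
  rewrite pochSr IH exprS factS mulnA [('C(k, i.+1) * _)%N]mulnC mul_bin_left.
  have [ik|ki] := leqP i k; last first.
    by rewrite bin_small// !mul0n !muln0 !mul0n !mulr0 mul0r.
  by rewrite !natrM natrB//; ring.
have fE i : r`!%:R * poch (1 + nu) r * f i =
    (-1) ^+ i * 'C(k, i)%:R * (tpoly nu r).[0 + i%:R].
  have p0 n : poch (1 + nu) n != 0 by have h := nu1; rewrite gt_eqF// poch_gt0//; lra.
  have i0 : i`!%:R != 0 :> R by rewrite pnatr_eq0 -lt0n fact_gt0.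
  have p1 : poch 1 i = i`!%:R :> R.
    by have := poch_nat R 0 i; rewrite mul1r add0r.
  have e1 := pochD (1 + nu) r i; have e2 := pochD (1 + nu) i r; rewrite addnC e1 in e2.
  have e3 := poch_nat R r i; have e4 := poch_nat R i r; rewrite addnC -e3 in e4.
  rewrite /f pk p1 expr1n add0r hornerM !pochp_eval natrM.
  rewrite [1 + r%:R]addrC [1 + i%:R]addrC.
  have -> : poch (1 + nu + i%:R) r = poch (1 + nu) r * poch (1 + nu + r%:R) i / poch (1 + nu) i.
    by rewrite e2 mulrC mulKf.
  have -> : poch (i%:R + 1) r = r`!%:R * poch (r%:R + 1) i / i`!%:R :> R.
    by rewrite -e4 mulrC mulKf.
  by have := p0 i => pi; field; apply/andP.
have -> : limn (series f) = \sum_(i < k.+1) f i.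
  (* The terms with [i > k] vanish, so the partial sums are constant from [k + 1] on. *)
  apply: lim_near_cst => //; exists k.+1 => // n /= kn.
  rewrite /series /= -(big_mkord xpredT f) (big_cat_nat (leq0n k.+1) kn)//=.
  rewrite [X in _ + X]big_nat_cond [X in _ + X]big1 ?addr0// => i /andP[/andP[ki _] _].
  by rewrite /f pk bin_small// mul0n mulr0 !mul0r.
by rewrite mulr_sumr; apply: eq_bigr => i _; rewrite fE.
Qed.

Variable P : nat -> {poly R}.
Hypothesis hP : orthonormal_polys nu P.

Lemma fcoefE n k :
  fcoef nu P n k = \sum_(r < n.+1) (P n)`_r * (iter k (@bdiff R) (tpoly nu r)).[0].
Proof.
rewrite /fcoef mulr_sumr; apply: eq_bigr => r _.
rewrite -hyp3F2_bdiff [in RHS](coef_orthonormal nu1 hP); last by rewrite -ltnS.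
by rewrite !mulrA.
Qed.

Lemma gcoef_sum x (Y : nat -> R) n :
    (forall j, Y j.+2 + (nu - j.+1%:R) * Y j.+1 = x * Y j) ->
  \sum_(k < (2 * n).+1) \sum_(j < k.+1) gcoef nu P n k j * Y j =
  (P n).[x] / n`!%:R * Y 0%N.
Proof.
move=> HY.
transitivity (\sum_(r < n.+1) (P n)`_r / n`!%:R * (x ^+ r * Y 0%N)); last first.
  case: hP => sP _ _; rewrite horner_coef sP !mulr_suml.
  by apply: eq_bigr => r _; rewrite !mulrA [_ / _ * _]mulrAC.
transitivity (\sum_(r < n.+1) \sum_(k < (2 * n).+1) \sum_(j < k.+1)
  (P n)`_r / n`!%:R * ((-1) ^+ j * (k`!%:R / j`!%:R) * (iter k (@bdiff R) (tpoly nu r)).[0] /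
      (j`!%:R * (k - j)%N`!%:R) * Y j)).
  rewrite exchange_big /=; apply: eq_bigr => k _; rewrite exchange_big /=.
  apply: eq_bigr => j _; rewrite /gcoef fcoefE.
  rewrite mulr_sumr !mulr_suml; apply: eq_bigr => r _.
  by rewrite !invfM; ring.
apply: eq_bigr => r _; rewrite -(@laguerre_sum _ nu x Y r (2 * n))//; last by have := ltn_ord r; lia.
by rewrite mulr_sumr; apply: eq_bigr => k _; rewrite mulr_sumr.
Qed.

Lemma xr_mac (mu x : R) j : xr mu x j%:Z = mac mu x j.
Proof.
rewrite /xr /mac; congr (_ * _).
have jj : (j./2 <= j)%N by rewrite -divn2 leq_div.
rewrite [RHS](eq_bigl xpredT)// -(subnKC jj) -addSn big_split_ord /=.
rewrite subnKC// [X in _ = _ + X]big1 ?addr0 => [|i _]; last first.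
  rewrite mac_coef_eq0 ?mul0r//.
  by have := odd_double_half j; rewrite -mul2n; case: (odd j) => /=; lia.
apply: eq_bigr => i _; rewrite mac_coefE; first by rewrite mulrA mulrAC.
by rewrite mul2n -geq_half_double -ltnS.
Qed.

Lemma sum_gcoef_xr x n :
  \sum_(k < (2 * n).+1) \sum_(j < k.+1) gcoef nu P n k j * xr nu x j%:Z =
  (P n).[x] / n`!%:R.
Proof.
under eq_bigr do under eq_bigr do rewrite xr_mac.
by rewrite (@gcoef_sum x) ?mac0 ?mulr1// => j; exact: mac_rec.
Qed.

(** Lowering both [nu] and [j] by 1 leaves [nu - j] unchanged, so the shifted sequence solves the
    recurrence of [gcoef_sum]; the convention [r_(-1) = 0] gives it the initial value 0. *)
Lemma sum_gcoef_xr_pred x n :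
  \sum_(k < (2 * n).+1) \sum_(j < k.+1) gcoef nu P n k j * xr (nu - 1) x (j%:Z - 1) = 0.
Proof.
apply: (etrans (@gcoef_sum x (fun j => xr (nu - 1) x (j%:Z - 1)) n _)); last first.
  by rewrite [X in _ * X](_ : _ = 0) ?mulr0.
move=> j.
have pS i : i.+1%:Z - 1 = i%:Z by rewrite -addn1 PoszD addrK.
rewrite !pS !xr_mac.
(* At [j = 0] the recurrence involves [r_(-1)] and reads [- (nu - 1) + (nu - 1) = 0]. *)
case: j => [|j]; first by rewrite mac1 mac0 mulr0; ring.
rewrite pS xr_mac -mac_rec; congr (_ + _ * _).
by rewrite -[j.+2%:R]natr1; ring.
Qed.

End Expansion_coefficients.

(** * Comparison test for complex series, through real and imaginary parts *)

Section Complex_series.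
Variable R : realType.
Implicit Types (z : R[i]) (u : nat -> R[i]^o).

Local Notation cnorm z := (complex.Re `|z|).

Lemma cnormE z : `|z| = (cnorm z)%:C.
Proof. by rewrite normc_def. Qed.

Lemma cnorm_real (r : R) : `|r%:C| = `|r|%:C.
Proof. by rewrite normc_def /= expr0n /= addr0 sqrtr_sqr. Qed.

Lemma cnorm_ge_Re z : `|complex.Re z| <= cnorm z.
Proof.
rewrite normc_def /= -sqrtr_sqr ler_wsqrtr// lerDl sqr_ge0//.
Qed.

Lemma cnorm_ge_Im z : `|complex.Im z| <= cnorm z.
Proof.
rewrite normc_def /= -sqrtr_sqr ler_wsqrtr// lerDr sqr_ge0//.
Qed.

Lemma cnorm_le z : cnorm z <= `|complex.Re z| + `|complex.Im z|.
Proof.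
rewrite normc_def /= -[leRHS]ger0_norm ?addr_ge0// -sqrtr_sqr ler_wsqrtr//.
rewrite -(real_normK (num_real (complex.Re z))) -(real_normK (num_real (complex.Im z))).
by have := normr_ge0 (complex.Re z); have := normr_ge0 (complex.Im z); nra.
Qed.

Lemma cvg_Re_Im u (l : R[i]) :
  complex.Re (u n) @[n --> \oo] --> complex.Re l ->
  complex.Im (u n) @[n --> \oo] --> complex.Im l ->
  u n @[n --> \oo] --> (l : R[i]^o).
Proof.
move=> ul vl; apply/cvgrPdist_lt => e e0.
have [eIm eRe] : complex.Im e = 0 /\ 0 < complex.Re e.
  by move: e0; rewrite ltcE /= => /andP[/eqP].
have e2 : 0 < complex.Re e / 2 by rewrite divr_gt0.
have /cvgrPdist_lt/(_ _ e2) H1 := ul; have /cvgrPdist_lt/(_ _ e2) H2 := vl.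
near=> n.
rewrite cnormE ltcE /= eIm eqxx /=; apply: le_lt_trans (cnorm_le _) _.
rewrite [ltRHS]splitr !raddfB /=; apply: ltrD; near: n; [exact: H1|exact: H2].
Unshelve. all: by end_near. Qed.

Lemma cvg_series_dominated u (v : nat -> R) :
  (forall n, cnorm (u n) <= v n) -> cvgn (series v) -> cvgn (series u).
Proof.
move=> uv cv.
have v0 n : 0 <= v n by rewrite (le_trans _ (uv n))// (le_trans _ (cnorm_ge_Re _)).
have cw (w : nat -> R) : (forall n, `|w n| <= v n) -> cvgn (series w).
  move=> wv; apply: normed_cvg; apply: (series_le_cvg _ v0) => // n.
  exact: normr_ge0.
have /cvg_ex[a ua] := cw (fun n => complex.Re (u n)) (fun n => le_trans (cnorm_ge_Re _) (uv n)).
have /cvg_ex[b ub] := cw (fun n => complex.Im (u n)) (fun n => le_trans (cnorm_ge_Im _) (uv n)).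
apply/cvg_ex; exists (a +i* b); apply: cvg_Re_Im => /=.
- by apply: cvg_trans ua; apply: near_eq_cvg; near=> n; rewrite /series /= raddf_sum.
- by apply: cvg_trans ub; apply: near_eq_cvg; near=> n; rewrite /series /= raddf_sum.
Unshelve. all: by end_near. Qed.

End Complex_series.

Lemma orthonormal_series_cvg (R : realType) (nu : R) (P : nat -> {poly R}) (x : R)
    (z : R[i]) : -1 < nu -> orthonormal_polys nu P -> 0 < x ->
  cvgn (series (fun n : nat => ((P n).[x] / n`!%:R)%:C * z ^+ n : R[i]^o)).
Proof.
move=> nu1 hP x0; have [K K0 bnd] := weight_pointwise_bound nu1 x0.
(* As [n + 1 <= 2^n], the bound [2^(n+1) (n+1) K] is at most [2 K 4^n], so the exponential series at
   [4 |z|] dominates. *)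
pose t : R := 4 * complex.Re `|z|.
apply: (@cvg_series_dominated R _ (fun n => 2 * K * exp_coeff t n)).
  move=> n.
  have -> : complex.Re `|((P n).[x] / n`!%:R)%:C * z ^+ n| =
     `|(P n).[x]| / n`!%:R * (complex.Re `|z|) ^+ n.
    rewrite normrM normrX (cnormE z) cnorm_real -rmorphXn -rmorphM.
    by rewrite [LHS]/= normrM normfV normr_nat.
  have zn : 0 <= complex.Re `|z| by rewrite (le_trans _ (cnorm_ge_Re z)).
  rewrite /exp_coeff /= /t exprMn.
  have -> : 2 * K * (4 ^+ n * complex.Re `|z| ^+ n / n`!%:R) =
     2 * K * 4 ^+ n / n`!%:R * complex.Re `|z| ^+ n by ring.
  rewrite ler_wpM2r ?exprn_ge0// ler_wpM2r ?invr_ge0//.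
  apply: le_trans (bnd (P n) n _ _) _.
  - by case: hP => ->.
  - by rewrite (mom_orthonormal nu1 hP) eqxx.
  - have -> : 4 ^+ n = 2 ^+ n * 2 ^+ n :> R by rewrite -exprMn; congr (_ ^+ n); ring.
    rewrite exprS.
    have -> : 2 * 2 ^+ n * n.+1%:R * K = 2 * K * 2 ^+ n * n.+1%:R by ring.
    rewrite mulrA ler_wpM2l ?mulr_ge0 ?exprn_ge0// -natrX ler_nat.
    exact: ltn_expl.
have -> : series (fun n => 2 * K * exp_coeff t n) = (fun n => 2 * K * series (exp_coeff t) n).
  by apply/funext => n; rewrite /series /= mulr_sumr.
by apply: is_cvgMl_tmp; exact: is_cvg_series_exp_coeff.
Qed.

Unset Implicit Arguments.

Theorem mainTheorem4 (R : realType) (nu : R) (P : nat -> {poly R}) (x : R)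
    (hnu : -1 < nu) (hP : orthonormal_polys nu P) (hx : 0 < x) :
  let h := convergence_radius (fun n : nat => (P n).[x] / n`!%:R) in
  (0 < h)%E /\
  forall z : R[i], ((complex.Re `|z|)%:E < h)%E ->
    let G : nat -> R[i]^o := fun n : nat => ((P n).[x] / n`!%:R)%:C * z ^+ n in
    let S1 : nat -> R[i]^o := fun n : nat =>
      (\sum_(k < (2 * n).+1) \sum_(j < k.+1)
         gcoef nu P n k j * xr nu x j%:Z)%:C * z ^+ n in
    let S2 : nat -> R[i]^o := fun n : nat =>
      (\sum_(k < (2 * n).+1) \sum_(j < k.+1)
         gcoef nu P n k j * xr (nu - 1) x (j%:Z - 1))%:C * z ^+ n in
    [/\ cvgn (series G), cvgn (series S1), cvgn (series S2) &
        limn (series G) =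
          limn (series S1) +
          (rho (nu + 1) x / rho nu x)%:C * limn (series S2)].
Proof.
move=> h; have cG z := @orthonormal_series_cvg R nu P x z hnu hP hx.
split.
  (* The series converges at [z = 1], which already gives [h >= 1]. *)
  apply: (@lt_le_trans _ _ 1%E); first exact: lte01.
  apply: ereal_sup_ubound; exists 1; first exact: cG.
  by rewrite normr1.
move=> z _ G S1 S2.
have -> : S1 = G.
  by apply/funext => n; rewrite /S1 sum_gcoef_xr.
have -> : S2 = fun=> 0.
  by apply/funext => n; rewrite /S2 sum_gcoef_xr_pred// rmorph0 mul0r.
have -> : series (fun=> 0 : R[i]^o) = cst 0.
  by apply/funext => n; rewrite /series /= big1.
split; [exact: cG|exact: cG|exact: is_cvg_cst|].
by rewrite lim_cst// mulr0 addr0.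
Qed.
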